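(* There are positive numerical (absolute) constants $\gamma$ and $M$ such that the following holds. Let $\phi$ be a positive continuous function on $(0,1)$ such that $g(x)=\int_x^1\frac{\phi^2(t)}{t}\,dt<\infty$ for all $0<x<1$. Then for all $f\in B_\phi$ with $f(0)=0$ and $f\not\equiv 0$, and all $0<r<1$, $$\int_T \exp\left(\frac{\gamma\,|f(r\zeta)|}{\|f\|_{B_\phi}\sqrt{g(1-r^2)}}\right)dm(\zeta)\le M.$$
   Context: $D=\{z\in\mathbb{C}:|z|<1\}$ is the open unit disk, $T=\{z\in\mathbb{C}:|z|=1\}$ is the unit circle, and $m$ is normalized Lebesgue measure on $T$, so $m(T)=1$. For a positive continuous function $\phi$ on $(0,1)$, $B_\phi$ denotes the space of all analytic functions $f$ in $D$ with $$\|f\|_{B_\phi}=\sup_{z\in D,\ z\neq 0}\frac{(1-|z|^2)\,|f'(z)|}{\phi(1-|z|^2)}<\infty.$$ ''Numerical constants'' means that $\gamma$ and $M$ do not depend on $\phi$, $f$ or $r$. *)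

(* Defs.v *)
From Stdlib Require Import Reals.
From Coquelicot Require Import Coquelicot.

Open Scope R_scope.

Definition in_disk (z : C) : Prop := Cmod z < 1.

(** Near each point of the disk, [f] is the sum of a convergent power series.
    Functions on the disk are represented by total functions on [C]; their
    values off the disk are irrelevant. *)
Definition analytic_on_disk (f : C -> C) : Prop :=
  forall z0 : C, in_disk z0 ->
    exists (a : nat -> C) (e : posreal),
      forall z : C, Cmod (z - z0) < e ->
        @is_pseries C_AbsRing C_NormedModule a (z - z0)%C (f z).

(** The supremum is taken in the extended reals, so it may be [p_infty]. *)
Definition B_norm (phi : R -> R) (f : C -> C) : Rbar :=
  Lub_Rbar (fun y : R => exists z : C, in_disk z /\ z <> RtoC 0 /\
    y = (1 - Cmod z ^ 2) * Cmod (C_derive f z) / phi (1 - Cmod z ^ 2)).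

Definition in_B (phi : R -> R) (f : C -> C) : Prop :=
  analytic_on_disk f /\ Rbar_lt (B_norm phi f) p_infty.

(** For [phi] positive and continuous on (0,1) the integral from [x] to [1] of
    [phi(t)^2 / t] can only be improper at [1], and it is finite exactly when
    the improper Riemann integral converges. *)
Definition g_finite (phi : R -> R) (x : R) : Prop :=
  ex_RInt_gen (fun t : R => phi t ^ 2 / t) (at_point x) (at_left 1).

Definition g (phi : R -> R) (x : R) : R :=
  RInt_gen (fun t : R => phi t ^ 2 / t) (at_point x) (at_left 1).

(** Integral over the unit circle against normalized Lebesgue measure, through
    the parametrization [theta |-> cos theta + i sin theta]. *)
Definition circle_integral (u : C -> R) : R :=
  / (2 * PI) * RInt (fun theta : R => u (cos theta, sin theta)) 0 (2 * PI).

(* Main.v *)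
Require Import Defs.
From Stdlib Require Import Reals Lra Lia.
From Coquelicot Require Import Coquelicot.

Open Scope R_scope.

(** Write [K] for the norm of [f], [D] for the operator [r d/dr], and [J_n(r)]
    for the integral over the angle of [|f|^(2n)] on the circle of radius [r].

    The proof bounds every moment [J_n].  For a holomorphic [F], put
    [P(z) = z F'(z)].  Hardy's identity ([hardy_identity]) says that [D^2] of
    the integral of [|F|^2] is [4] times the integral of [|P|^2]: in polar
    coordinates the two differ by an angular derivative, whose integral over
    a full turn vanishes.  Apply this to [F = f^n] and insert
    [|f'| <= K phi(1-r^2) / (1-r^2)].  In terms of [G(r) = g(1-r^2)], for
    which [D G = 2 r^2 phi^2(1-r^2) / (1-r^2)], the result is
    [(1-r^2) D^2 J_n <= 2 n^2 K^2 (D G) J_(n-1)].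

    Let [V_n = 2 PI 2^n n! (K^2 G)^n].  If [J_(n-1) <= V_(n-1)], then
    [(1-r^2) D^2 J_n <= D V_n], and this implies [J_n <= V_n]
    ([circ_comparison]).  The factor [1-r^2], which makes the bound involve
    the integral of [phi^2(t)/t] instead of [phi^2(t)/t^2], is absorbed in the
    two integrations from [D^2 J_n] back to [J_n].  Near the origin this needs
    [D J >= 2 J] for the mean square [J] of a function vanishing at [0]
    ([circ_dot_le_circ_dot_euler]), which in turn holds because the mean
    square of [F(z)/z] increases with the radius.

    By induction ([moment_bound]) [J_n <= V_n] for all [n].  With
    [x = |f| / (K sqrt G)], one has [exp (x/2) <= exp (1/4) exp (x^2/4)], and
    the [n]-th term of the Taylor series of [exp (x^2/4)] has integral at most
    [2 PI / 2^n]; so [gamma = 1/2] and [M = 3 exp (1/4)] work.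

    All differentiations take place in the coordinates [(t, theta)] with
    [z = e^t (cos theta + i sin theta)], in which [D] is [d/dt].  Since
    analyticity is given by local power series, the first step is to
    differentiate such a series term by term ([pseries_cderiv]), which shows
    that [f] is infinitely often complex differentiable. *)

(* The two sides of an equation produced by the derivative rules may be typed
   in a canonical structure over [R]; [ring] needs to see the carrier [R]. *)
Ltac real_ring :=
  match goal with |- @eq _ ?x ?y => change (@eq R x y) end; ring.

(** * Complex derivatives and power series *)

(** [F] has complex derivative [l] at [z], in epsilon-delta form. *)
Definition cderiv (F : C -> C) (z l : C) : Prop :=
  forall eps : R, 0 < eps -> exists d : R, 0 < d /\
    forall w : C, Cmod (w - z) < d ->
      Cmod (F w - F z - l * (w - z)) <= eps * Cmod (w - z).

Lemma cderiv_is_derive (F : C -> C) (z l : C) :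
  cderiv F z l -> @is_derive C_AbsRing C_NormedModule F z l.
Proof.
  intros H; split.
  - apply is_linear_scal_l.
  - intros x Hx.
    apply (is_filter_lim_locally_unique (K := C_AbsRing) (V := AbsRing_NormedModule C_AbsRing)) in Hx.
    rewrite <- Hx.
    intros eps.
    destruct (H eps (cond_pos eps)) as [d [Hd Hw]].
    exists (mkposreal d Hd); intros w Hball.
    assert (Hlt : Cmod (w - z) < d) by exact Hball.
    generalize (Hw w Hlt); intros Hle.
    change (Cmod ((F w - F z) - (w - z) * l)%C <= eps * Cmod (w - z)).
    replace ((F w - F z) - (w - z) * l)%C with (F w - F z - l * (w - z))%C by ring.
    exact Hle.
Qed.

Lemma cderiv_C_derive (F : C -> C) (z l : C) : cderiv F z l -> C_derive F z = l.
Proof. intros H; apply is_C_derive_unique, cderiv_is_derive, H. Qed.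

Lemma pow_n_Cpow (z : C) (n : nat) : @pow_n C_Ring z n = (z ^ n)%C.
Proof. induction n as [|n IH]; [reflexivity|]. simpl. rewrite IH. reflexivity. Qed.

Lemma is_series_Cmod_le (u : nat -> C) (l : C) (v : nat -> R) :
  @is_series C_AbsRing C_NormedModule u l -> ex_series v ->
  (forall n, Cmod (u n) <= v n) -> Cmod l <= Series v.
Proof.
  intros Hu Hv Hle.
  assert (H1 : is_lim_seq (fun N => @norm C_AbsRing C_NormedModule (sum_n u N))
                 (@norm C_AbsRing C_NormedModule l)).
  { eapply filterlim_comp; [exact Hu | apply filterlim_norm]. }
  apply Series_correct in Hv.
  apply (is_lim_seq_le _ _ (Finite (Cmod l)) (Finite (Series v))) with (2 := H1) (3 := Hv).
  intros N. unfold sum_n.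
  eapply Rle_trans; [apply (@norm_sum_n_m C_AbsRing C_NormedModule)|].
  apply sum_n_m_le; intros k; apply Hle.
Qed.

(** The second-order Taylor remainder of the power [k+1].  For [k = 0] the
    exponent [pred k] is [0], but the factor [INR k] vanishes. *)
Lemma pow_remainder (h u : C) (rho : R) (k : nat) :
  Cmod h <= rho -> Cmod u <= rho ->
  Cmod (u ^ S k - h ^ S k - RtoC (INR (S k)) * h ^ k * (u - h)) <=
    INR k * INR (S k) * rho ^ pred k * Cmod (u - h) ^ 2.
Proof.
  intros Hh Hu.
  assert (Hr : 0 <= rho) by (apply Rle_trans with (2 := Hh), Cmod_ge_0).
  induction k as [|k IH].
  - replace (u ^ 1 - h ^ 1 - RtoC (INR 1) * h ^ 0 * (u - h))%C with (RtoC 0)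
      by (simpl; ring).
    rewrite Cmod_0; simpl; lra.
  - replace (u ^ S (S k) - h ^ S (S k) - RtoC (INR (S (S k))) * h ^ S k * (u - h))%C
      with (u * (u ^ S k - h ^ S k - RtoC (INR (S k)) * h ^ k * (u - h))
            + RtoC (INR (S k)) * h ^ k * (u - h) ^ 2)%C.
    2: { rewrite (S_INR (S k)), RtoC_plus, !Cpow_S. ring. }
    eapply Rle_trans; [apply Cmod_triangle|].
    rewrite !Cmod_mult, !Cmod_pow, Cmod_R, (Rabs_pos_eq (INR _)) by apply pos_INR.
    assert (HP : Cmod h ^ k <= rho ^ k)
      by (apply pow_incr; split; [apply Cmod_ge_0 | exact Hh]).
    set (D := Cmod (u - h) ^ 2) in *.
    assert (HD : 0 <= D) by apply pow2_ge_0.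
    assert (H1 : Cmod u * Cmod (u ^ S k - h ^ S k - RtoC (INR (S k)) * h ^ k * (u - h))
              <= rho * (INR k * INR (S k) * rho ^ pred k * D)).
    { apply Rmult_le_compat; try apply Cmod_ge_0; assumption. }
    assert (H2 : INR (S k) * Cmod h ^ k * D <= INR (S k) * rho ^ k * D).
    { apply Rmult_le_compat_r; [exact HD|].
      apply Rmult_le_compat_l; [apply pos_INR | exact HP]. }
    assert (H3 : rho * (INR k * INR (S k) * rho ^ pred k * D)
              = INR k * INR (S k) * rho ^ k * D).
    { destruct k as [|k]; [simpl; ring|]. simpl pred. simpl (rho ^ S k). ring. }
    assert (H4 : INR (S (S k)) = INR k + 2) by (rewrite !S_INR; ring).
    simpl pred. rewrite H4.
    assert (H5 : 0 <= INR (S k) * rho ^ k * D).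
    { apply Rmult_le_pos; [|exact HD].
      apply Rmult_le_pos; [apply pos_INR | apply pow_le; exact Hr]. }
    rewrite S_INR in *. lra.
Qed.

Lemma pseries_terms_to_0 (a : nat -> C) (r : R) (l : C) :
  0 <= r -> @is_pseries C_AbsRing C_NormedModule a (RtoC r) l ->
  is_lim_seq (fun n => Cmod (a n) * r ^ n) 0.
Proof.
  intros Hr Ha.
  apply is_lim_seq_incr_1.
  assert (H1 : filterlim (fun n => minus (sum_n (fun k => scal (@pow_n C_Ring (RtoC r) k) (a k)) (S n))
       (sum_n (fun k => scal (@pow_n C_Ring (RtoC r) k) (a k)) n)) eventually
      (locally (@minus (NormedModule.AbelianGroup C_AbsRing C_NormedModule) l l))).
  { set (s := sum_n (fun k => scal (@pow_n C_Ring (RtoC r) k) (a k))).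
    assert (Hs : filterlim s eventually (locally (T := C_NormedModule) l)) by exact Ha.
    assert (Hs1 : filterlim (fun n => s (S n)) eventually (locally (T := C_NormedModule) l)).
    { intros P HP. destruct (Hs P HP) as [N HN]. exists N; intros n Hn; apply HN; lia. }
    apply (filterlim_comp_2 (H := locally (T := C_NormedModule) (opp l))
      (fun n => s (S n)) (fun n => opp (s n)) plus Hs1).
    - eapply filterlim_comp; [exact Hs|].
      apply (@filterlim_opp C_AbsRing C_NormedModule).
    - apply (@filterlim_plus C_AbsRing C_NormedModule). }
  assert (H2 : is_lim_seq (fun n => @norm C_AbsRing C_NormedModule
       (minus (sum_n (fun k => scal (@pow_n C_Ring (RtoC r) k) (a k)) (S n))
       (sum_n (fun k => scal (@pow_n C_Ring (RtoC r) k) (a k)) n)))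
       (@norm C_AbsRing C_NormedModule (@minus (NormedModule.AbelianGroup C_AbsRing C_NormedModule) l l))).
  { eapply filterlim_comp; [exact H1 | apply filterlim_norm]. }
  assert (E0 : @norm C_AbsRing C_NormedModule
    (@minus (NormedModule.AbelianGroup C_AbsRing C_NormedModule) l l) = 0).
  { change (Cmod (l - l) = 0). replace (l - l)%C with (RtoC 0) by ring. apply Cmod_0. }
  rewrite E0 in H2.
  eapply is_lim_seq_ext; [|exact H2].
  intros n; simpl. rewrite sum_Sn.
  set (s := sum_n _ n).
  transitivity (Cmod (a (S n) * RtoC r ^ S n)).
  2: { rewrite Cmod_mult, Cmod_pow, Cmod_R, Rabs_pos_eq by exact Hr. reflexivity. }
  change (Cmod ((s + @pow_n C_Ring (RtoC r) (S n) * a (S n)) - s)%C = Cmod (a (S n) * RtoC r ^ S n)).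
  rewrite pow_n_Cpow. f_equal. ring.
Qed.

Lemma CV_radius_Cmod_gt (a : nat -> C) (r r1 : R) (l : C) :
  0 <= r < r1 -> @is_pseries C_AbsRing C_NormedModule a (RtoC r1) l ->
  Rbar_lt r (CV_radius (fun n => Cmod (a n))).
Proof.
  intros Hr Ha.
  apply Rbar_lt_le_trans with (Finite r1); [simpl; lra|].
  destruct (Rbar_le_lt_dec r1 (CV_radius (fun n => Cmod (a n)))) as [H|H]; [exact H|].
  exfalso.
  apply (CV_disk_outside (fun n => Cmod (a n)) r1).
  - rewrite Rabs_pos_eq by lra. exact H.
  - apply pseries_terms_to_0 with l; [lra | exact Ha].
Qed.

(** A power series may be differentiated term by term inside its disk of
    convergence. *)
Lemma pseries_cderiv (a : nat -> C) (F : C -> C) (e : R) :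
  (forall h : C, Cmod h < e -> @is_pseries C_AbsRing C_NormedModule a h (F h)) ->
  forall h : C, Cmod h < e -> exists l : C,
    @is_pseries C_AbsRing C_NormedModule (fun n => (RtoC (INR (S n)) * a (S n))%C) h l /\
    cderiv F h l.
Proof.
  intros HF h Hh.
  pose proof (Cmod_ge_0 h) as Hh0.
  (* Two intermediate radii: convergence at [rho1] gives absolute convergence
     of all derived series at [rho]. *)
  set (rho := (Cmod h + e) / 2).
  set (rho1 := (rho + e) / 2).
  assert (Hrho : Cmod h < rho < rho1) by (unfold rho1, rho; lra).
  assert (Hrho1 : rho1 < e) by (unfold rho1, rho; lra).
  set (A := fun n => Cmod (a n)).
  assert (HCV : Rbar_lt rho (CV_radius A)).
  { apply CV_radius_Cmod_gt with (r1 := rho1) (l := F (RtoC rho1)); [lra|].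
    apply HF. rewrite Cmod_R, Rabs_pos_eq; lra. }
  assert (HA0 : forall n, 0 <= A n) by (intros n; apply Cmod_ge_0).
  assert (HS1 : ex_series (fun n => PS_derive A n * rho ^ n)).
  { eapply ex_series_ext; [|apply (CV_disk_inside (PS_derive A) rho)].
    - intros n; simpl. apply Rabs_pos_eq.
      apply Rmult_le_pos; [|apply pow_le; lra].
      apply Rmult_le_pos; [apply pos_INR | apply HA0].
    - rewrite CV_radius_derive, Rabs_pos_eq by lra. exact HCV. }
  assert (HS2 : ex_series (fun n => PS_derive (PS_derive A) n * rho ^ n)).
  { eapply ex_series_ext; [|apply (CV_disk_inside (PS_derive (PS_derive A)) rho)].
    - intros n; simpl. apply Rabs_pos_eq.
      apply Rmult_le_pos; [|apply pow_le; lra].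
      apply Rmult_le_pos; [apply pos_INR|].
      apply Rmult_le_pos; [apply pos_INR | apply HA0].
    - rewrite !CV_radius_derive, Rabs_pos_eq by lra. exact HCV. }
  assert (Hl : exists l : C, @is_pseries C_AbsRing C_NormedModule
      (fun n => (RtoC (INR (S n)) * a (S n))%C) h l).
  { destruct (@ex_series_le C_AbsRing C_CompleteNormedModule
      (fun k => scal (@pow_n C_Ring h k) (RtoC (INR (S k)) * a (S k))%C)
      (fun n => PS_derive A n * rho ^ n)) as [l Hl].
    - intros n.
      change (Cmod (@pow_n C_Ring h n * (RtoC (INR (S n)) * a (S n)))%C <= PS_derive A n * rho ^ n).
      rewrite pow_n_Cpow, !Cmod_mult, Cmod_pow, Cmod_R, Rabs_pos_eq by apply pos_INR.
      unfold PS_derive. rewrite Rmult_comm.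
      apply Rmult_le_compat_l; [apply Rmult_le_pos; [apply pos_INR | apply HA0]|].
      apply pow_incr; lra.
    - exact HS1.
    - exists l; exact Hl. }
  destruct Hl as [l Hl].
  exists l; split; [exact Hl|].
  set (v := fun k => A (S k) * (INR k * INR (S k) * rho ^ pred k)).
  assert (Hv : ex_series v).
  { apply ex_series_incr_1. eapply ex_series_ext; [|exact HS2].
    intros n; unfold v, PS_derive. simpl pred.
    real_ring. }
  assert (Hv0 : 0 <= Rabs (Series v)) by apply Rabs_pos.
  (* The increment of [F] minus its linear part is a series of Taylor
     remainders of powers, hence quadratic in [u - h]. *)
  assert (Hbound : forall u, Cmod u < rho ->
      Cmod (F u - F h - l * (u - h)) <= Rabs (Series v) * Cmod (u - h) ^ 2).
  { intros u Hu.
    apply Rle_trans with (Series v * Cmod (u - h) ^ 2);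
      [|apply Rmult_le_compat_r; [apply pow2_ge_0 | apply Rle_abs]].
    rewrite <- Series_scal_r.
    apply is_series_Cmod_le with
      (u := fun k => (a (S k) * (u ^ S k - h ^ S k - RtoC (INR (S k)) * h ^ k * (u - h)))%C).
    - assert (Hs : forall w, Cmod w < e -> @is_series C_AbsRing C_NormedModule
          (fun k => scal (@pow_n C_Ring w (S k)) (a (S k))) (F w - a O)%C).
      { intros w Hw.
        apply (is_series_incr_1 (fun k => scal (@pow_n C_Ring w k) (a k))).
        replace (plus _ _) with (F w); [apply HF, Hw|].
        change (F w = ((F w - a O) + (RtoC 1 * a O))%C). ring. }
      assert (Hs1 := Hs u ltac:(lra)). assert (Hs2 := Hs h ltac:(lra)).
      assert (Hs3 := is_series_scal_l (K := C_AbsRing) (V := C_NormedModule) (u - h)%C _ _ Hl).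
      assert (Hs4 := is_series_minus (K := C_AbsRing) (V := C_NormedModule) _ _ _ _
        (is_series_minus (K := C_AbsRing) (V := C_NormedModule) _ _ _ _ Hs1 Hs2) Hs3).
      replace (F u - F h - l * (u - h))%C with
        ((F u - a O) - (F h - a O) - (u - h) * l)%C by ring.
      eapply is_series_ext; [|exact Hs4].
      intros n; cbv beta.
      change ((@pow_n C_Ring u (S n) * a (S n) - @pow_n C_Ring h (S n) * a (S n)
         - (u - h) * (@pow_n C_Ring h n * (RtoC (INR (S n)) * a (S n))))%C
         = (a (S n) * (u ^ S n - h ^ S n - RtoC (INR (S n)) * h ^ n * (u - h)))%C).
      rewrite !pow_n_Cpow.
      match goal with |- @eq _ ?x ?y => change (@eq C x y) end.
      replace (pow_n h n) with (h ^ n)%C by (symmetry; apply pow_n_Cpow).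
      replace (pow_n h (S n)) with (h ^ S n)%C by (symmetry; apply pow_n_Cpow). ring.
    - apply ex_series_scal_r, Hv.
    - intros n. rewrite Cmod_mult. unfold v. rewrite Rmult_assoc.
      apply Rmult_le_compat_l; [apply Cmod_ge_0|].
      apply pow_remainder; lra. }
  intros eps Heps.
  exists (Rmin (rho - Cmod h) (eps / (Rabs (Series v) + 1))).
  assert (Hq : 0 < eps / (Rabs (Series v) + 1)) by (apply Rdiv_lt_0_compat; lra).
  split; [apply Rmin_glb_lt; lra|].
  intros w Hw.
  assert (Hw1 : Cmod (w - h) < rho - Cmod h) by (eapply Rlt_le_trans; [exact Hw | apply Rmin_l]).
  assert (Hw2 : Cmod (w - h) < eps / (Rabs (Series v) + 1)) by (eapply Rlt_le_trans; [exact Hw | apply Rmin_r]).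
  eapply Rle_trans; [apply Hbound|].
  - replace w with ((w - h) + h)%C by ring.
    eapply Rle_lt_trans; [apply Cmod_triangle|]. lra.
  - pose proof (Cmod_ge_0 (w - h)) as Hw0.
    simpl. rewrite Rmult_1_r, <- Rmult_assoc.
    apply Rmult_le_compat_r; [exact Hw0|].
    apply Rle_trans with ((Rabs (Series v) + 1) * (eps / (Rabs (Series v) + 1))).
    + apply Rmult_le_compat; lra.
    + right; field; lra.
Qed.

Lemma cderiv_shift (f : C -> C) (z0 h l : C) :
  cderiv (fun k => f (z0 + k)%C) h l -> cderiv f (z0 + h) l.
Proof.
  intros H eps Heps. destruct (H eps Heps) as [d [Hd Hw]].
  exists d; split; [exact Hd|]. intros w Hwd.
  assert (E : ((w - z0) - h)%C = (w - (z0 + h))%C) by ring.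
  specialize (Hw (w - z0)%C). rewrite E in Hw.
  replace (z0 + (w - z0))%C with w in Hw by ring.
  apply Hw, Hwd.
Qed.

(** Since [C_derive f] is again analytic, this lemma can be iterated. *)
Lemma analytic_derive (f : C -> C) :
  analytic_on_disk f ->
  analytic_on_disk (C_derive f) /\
  (forall z, in_disk z -> cderiv f z (C_derive f z)).
Proof.
  intros Hf.
  assert (H : forall z0, in_disk z0 -> exists (a : nat -> C) (e : posreal),
     forall h, Cmod h < e ->
       @is_pseries C_AbsRing C_NormedModule a h (C_derive f (z0 + h)) /\
       cderiv f (z0 + h) (C_derive f (z0 + h))).
  { intros z0 Hz0. destruct (Hf z0 Hz0) as [a [e Ha]].
    exists (fun n => (RtoC (INR (S n)) * a (S n))%C), e.
    intros h Hh.
    destruct (pseries_cderiv a (fun k => f (z0 + k)%C) e) with (h := h) as [l [Hl1 Hl2]].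
    - intros k Hk.
      assert (E : ((z0 + k) - z0)%C = k) by ring.
      specialize (Ha (z0 + k)%C). rewrite E in Ha. apply Ha, Hk.
    - exact Hh.
    - apply cderiv_shift in Hl2.
      rewrite (cderiv_C_derive _ _ _ Hl2). split; assumption. }
  split.
  - intros z0 Hz0. destruct (H z0 Hz0) as [a [e Ha]]. exists a, e.
    intros z Hz. destruct (Ha _ Hz) as [H1 _].
    replace (z0 + (z - z0))%C with z in H1 by ring. exact H1.
  - intros z Hz. destruct (H z Hz) as [a [e Ha]].
    destruct (Ha (RtoC 0)) as [_ H1].
    + rewrite Cmod_0. apply cond_pos.
    + replace (z + RtoC 0)%C with z in H1 by ring. exact H1.
Qed.

Lemma is_derive_cderiv (F : C -> C) (z l : C) :
  @is_derive C_AbsRing (AbsRing_NormedModule C_AbsRing) F z l -> cderiv F z l.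
Proof.
  intros [_ H] eps Heps.
  destruct (H z (fun P HP => HP) (mkposreal eps Heps)) as [d Hd].
  exists d; split; [apply cond_pos|]. intros w Hw.
  specialize (Hd w Hw).
  change (Cmod ((F w - F z) - (w - z) * l)%C <= eps * Cmod (w - z)) in Hd.
  replace (F w - F z - l * (w - z))%C with ((F w - F z) - (w - z) * l)%C by ring.
  exact Hd.
Qed.

(** The same derivative with values in [C] seen as a normed module over itself,
    the form in which the product rule [is_derive_mult] is stated. *)
Lemma cderiv_is_derive_abs (F : C -> C) (z l : C) :
  cderiv F z l -> @is_derive C_AbsRing (AbsRing_NormedModule C_AbsRing) F z l.
Proof.
  intros H. apply cderiv_is_derive in H.
  split; [apply is_linear_scal_l; intros n m; apply Cmult_comm | exact (proj2 H)].
Qed.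

Lemma cderiv_mult (F G : C -> C) (z lF lG : C) :
  cderiv F z lF -> cderiv G z lG ->
  cderiv (fun w => F w * G w)%C z (lF * G z + F z * lG)%C.
Proof.
  intros HF HG. apply is_derive_cderiv.
  apply (@is_derive_mult C_AbsRing F G z lF lG).
  - exact (cderiv_is_derive_abs _ _ _ HF).
  - exact (cderiv_is_derive_abs _ _ _ HG).
  - intros n m; apply Cmult_comm.
Qed.

Lemma cderiv_plus (F G : C -> C) (z lF lG : C) :
  cderiv F z lF -> cderiv G z lG -> cderiv (fun w => F w + G w)%C z (lF + lG)%C.
Proof.
  intros HF HG. apply is_derive_cderiv.
  apply (@is_derive_plus C_AbsRing (AbsRing_NormedModule C_AbsRing) F G z lF lG).
  - exact (cderiv_is_derive_abs _ _ _ HF).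
  - exact (cderiv_is_derive_abs _ _ _ HG).
Qed.

Lemma cderiv_id (z : C) : cderiv (fun w => w) z (RtoC 1).
Proof. apply is_derive_cderiv. apply (@is_derive_id C_AbsRing). Qed.

Lemma cderiv_const (c z : C) : cderiv (fun _ => c) z (RtoC 0).
Proof. apply is_derive_cderiv. apply (@is_derive_const C_AbsRing (AbsRing_NormedModule C_AbsRing)). Qed.

Lemma cderiv_continuous (F : C -> C) (z l : C) : cderiv F z l -> continuous F z.
Proof.
  intros H. apply cderiv_is_derive in H.
  assert (Hc := ex_derive_continuous (K := C_AbsRing) (V := C_NormedModule) F z (ex_intro _ l H)).
  intros P HP. apply locally_C. exact (Hc P HP).
Qed.

(** The Cauchy-Riemann equations. *)
Lemma cderiv_Cauchy_Riemann (F : C -> C) (z l : C) :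
  cderiv F z l ->
  differentiable_pt_lim (fun x y => Re (F (x, y))) (Re z) (Im z) (Re l) (- Im l) /\
  differentiable_pt_lim (fun x y => Im (F (x, y))) (Re z) (Im z) (Im l) (Re l).
Proof.
  intros H.
  assert (H' : forall eps : posreal, locally_2d (fun u v =>
     Cmod (F (u, v) - F z - l * ((u, v) - z)) <=
     eps * Rmax (Rabs (u - Re z)) (Rabs (v - Im z))) (Re z) (Im z)).
  { intros eps. pose proof (cond_pos eps) as He.
    destruct (H (eps / 2)) as [d [Hd Hw]]; [lra|].
    assert (Hd2 : 0 < d / 2) by lra.
    exists (mkposreal _ Hd2); intros u v Hu Hv; simpl in Hu, Hv.
    assert (Hm : Cmod ((u, v) - z) <= 2 * Rmax (Rabs (u - Re z)) (Rabs (v - Im z))).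
    { eapply Rle_trans; [apply Cmod_2Rmax|].
      apply Rmult_le_compat; [apply sqrt_pos | | | apply Rle_refl].
      - eapply Rle_trans; [apply Rabs_pos | apply Rmax_l].
      - rewrite <- (sqrt_Rsqr 2) at 2 by lra. apply sqrt_le_1_alt. unfold Rsqr; lra. }
    eapply Rle_trans; [apply Hw|].
    - eapply Rle_lt_trans; [exact Hm|].
      assert (Rmax (Rabs (u - Re z)) (Rabs (v - Im z)) < d / 2) by (apply Rmax_lub_lt; assumption).
      lra.
    - replace (eps * Rmax (Rabs (u - Re z)) (Rabs (v - Im z))) with
        (eps / 2 * (2 * Rmax (Rabs (u - Re z)) (Rabs (v - Im z)))) by field.
      apply Rmult_le_compat_l; [lra | exact Hm]. }
  assert (Ez : F (Re z, Im z) = F z) by (destruct z; reflexivity).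
  split; intros eps; destruct (H' eps) as [d Hd]; exists d; intros u v Hu Hv;
    (eapply Rle_trans; [|exact (Hd u v Hu Hv)]); rewrite Ez;
    (eapply Rle_trans; [|apply Rmax_Cmod]).
  - eapply Rle_trans; [|apply Rmax_l]. right. apply f_equal. unfold Re, Im. destruct l, z. simpl. ring.
  - eapply Rle_trans; [|apply Rmax_r]. right. apply f_equal. unfold Re, Im. destruct l, z. simpl. ring.
Qed.

(** * Logarithmic polar coordinates *)

(** The point of modulus [exp t] and argument [th]; the disk without its centre
    corresponds to [t < 0]. *)
Definition polar (t th : R) : C := (exp t * cos th, exp t * sin th).

Lemma Cmod_polar (t th : R) : Cmod (polar t th) = exp t.
Proof.
  unfold Cmod, polar; simpl.
  replace (exp t * cos th * (exp t * cos th * 1) + exp t * sin th * (exp t * sin th * 1))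
    with (Rsqr (exp t)).
  - apply sqrt_Rsqr. apply Rlt_le, exp_pos.
  - generalize (sin2_cos2 th); unfold Rsqr; intros E.
    transitivity (exp t * exp t * (sin th * sin th + cos th * cos th)); [rewrite E; ring | ring].
Qed.

Lemma polar_in_disk (t th : R) : t < 0 -> in_disk (polar t th).
Proof.
  intros H. unfold in_disk. rewrite Cmod_polar. rewrite <- exp_0. apply exp_increasing, H.
Qed.

Lemma is_derive_re_im_curve (F : C -> C) (x y : R -> R) (s dx dy : R) (l : C) :
  cderiv F (x s, y s) l -> is_derive x s dx -> is_derive y s dy ->
  is_derive (fun t => Re (F (x t, y t))) s (Re (l * (dx, dy))) /\
  is_derive (fun t => Im (F (x t, y t))) s (Im (l * (dx, dy))).
Proof.
  intros H Hx Hy. apply cderiv_Cauchy_Riemann in H. destruct H as [H1 H2].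
  apply is_derive_Reals in Hx. apply is_derive_Reals in Hy.
  split; apply is_derive_Reals.
  - replace (Re (l * (dx, dy))) with (Re l * dx + - Im l * dy) by (destruct l; simpl; ring).
    exact (derivable_pt_lim_comp_2d _ _ _ _ _ _ _ _ H1 Hx Hy).
  - replace (Im (l * (dx, dy))) with (Im l * dx + Re l * dy) by (destruct l; simpl; ring).
    exact (derivable_pt_lim_comp_2d _ _ _ _ _ _ _ _ H2 Hx Hy).
Qed.

(** In the coordinates [(t, th)] the radial derivative of [F] is [z F'(z)] and
    the angular one, below, is [i z F'(z)]. *)
Lemma is_derive_polar_radial (F : C -> C) (t th : R) (l : C) :
  cderiv F (polar t th) l ->
  is_derive (fun s => Re (F (polar s th))) t (Re (polar t th * l)) /\
  is_derive (fun s => Im (F (polar s th))) t (Im (polar t th * l)).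
Proof.
  intros H. rewrite Cmult_comm.
  apply (is_derive_re_im_curve F (fun s => exp s * cos th) (fun s => exp s * sin th));
    [exact H | auto_derive; [exact I | ring] ..].
Qed.

Lemma is_derive_polar_angular (F : C -> C) (t th : R) (l : C) :
  cderiv F (polar t th) l ->
  is_derive (fun s => Re (F (polar t s))) th (- Im (polar t th * l)) /\
  is_derive (fun s => Im (F (polar t s))) th (Re (polar t th * l)).
Proof.
  intros H.
  destruct (is_derive_re_im_curve F (fun s => exp t * cos s) (fun s => exp t * sin s) th
    (- (exp t * sin th)) (exp t * cos th) l) as [H1 H2];
    [exact H | auto_derive; [exact I | ring] .. |].
  split.
  - replace (- Im (polar t th * l)) with (Re (l * (- (exp t * sin th), exp t * cos th)))
      by (destruct l; simpl; ring). exact H1.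
  - replace (Re (polar t th * l)) with (Im (l * (- (exp t * sin th), exp t * cos th)))
      by (destruct l; simpl; ring). exact H2.
Qed.

Lemma continuous_polar (u : C -> R) (t th : R) :
  continuous u (polar t th) ->
  continuous (fun p : R * R => u (polar (fst p) (snd p))) (t, th).
Proof.
  intros Hu.
  apply (continuous_comp_2 (fun p : R * R => exp (fst p) * cos (snd p))
    (fun p : R * R => exp (fst p) * sin (snd p)) (fun x y => u (x, y))).
  - apply (continuous_mult (K := R_AbsRing)).
    + apply (continuous_comp fst exp); [apply continuous_fst | apply continuous_exp].
    + apply (continuous_comp snd cos); [apply continuous_snd | apply continuous_cos].
  - apply (continuous_mult (K := R_AbsRing)).
    + apply (continuous_comp fst exp); [apply continuous_fst | apply continuous_exp].
    + apply (continuous_comp snd sin); [apply continuous_snd | apply continuous_sin].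
  - eapply continuous_ext; [|exact Hu]. intros [a b]; reflexivity.
Qed.

Lemma continuous_polar_angular (u : C -> R) (t th : R) :
  continuous u (polar t th) -> continuous (fun s => u (polar t s)) th.
Proof.
  intros Hu.
  apply (continuous_comp_2 (fun _ => t) (fun s : R => s) (fun a b => u (polar a b))).
  - apply continuous_const.
  - apply continuous_id.
  - apply continuous_polar, Hu.
Qed.

(** * Integrals over circles *)

(** The integral of [u] over the circle of radius [exp t] with respect to the
    angle, without normalisation. *)
Definition circ (u : C -> R) (t : R) : R := RInt (fun th => u (polar t th)) 0 (2 * PI).

(** [u] is continuous on the open unit disk. *)
Definition disk_cont (u : C -> R) : Prop := forall z : C, in_disk z -> continuous u z.

Lemma ex_RInt_circ (u : C -> R) (t : R) :
  disk_cont u -> t < 0 -> ex_RInt (fun th => u (polar t th)) 0 (2 * PI).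
Proof.
  intros Hu Ht. apply (ex_RInt_continuous (V := R_CompleteNormedModule)).
  intros th _. apply continuous_polar_angular, Hu, polar_in_disk, Ht.
Qed.

(** Differentiation under the integral sign. *)
Lemma is_derive_circ (u v : C -> R) (t : R) :
  (forall s th, s < 0 -> is_derive (fun x => u (polar x th)) s (v (polar s th))) ->
  disk_cont u -> disk_cont v -> t < 0 -> is_derive (circ u) t (circ v t).
Proof.
  intros Hd Hu Hv Ht.
  assert (Hn : locally t (fun s => s < 0)) by (apply open_lt; exact Ht).
  unfold circ.
  rewrite <- (RInt_ext (fun th => Derive (fun x => u (polar x th)) t)).
  2: { intros th _. apply is_derive_unique, Hd, Ht. }
  apply is_derive_RInt_param.
  - eapply filter_imp; [|exact Hn]. intros s Hs th _.
    eexists; apply Hd, Hs.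
  - intros th _. apply continuity_2d_pt_filterlim.
    cbv beta.
    replace (Derive (fun z : R => u (polar z th)) t) with (v (polar t th))
      by (symmetry; apply is_derive_unique, Hd, Ht).
    apply filterlim_ext_loc with (fun p : R * R => v (polar (fst p) (snd p))).
    + assert (Hn2 : locally (t, th) (fun p : R * R => fst p < 0)).
      { destruct Hn as [d Hd']. exists d. intros p [Hp _]. apply Hd', Hp. }
      eapply filter_imp; [|exact Hn2]. intros [a b] Ha; simpl in *.
      symmetry. apply is_derive_unique, Hd, Ha.
    + apply (continuous_polar v), Hv, polar_in_disk, Ht.
  - eapply filter_imp; [|exact Hn]. intros s Hs. apply ex_RInt_circ; assumption.
Qed.

Lemma circ_le (u v : C -> R) (t : R) :
  disk_cont u -> disk_cont v -> t < 0 ->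
  (forall th, u (polar t th) <= v (polar t th)) -> circ u t <= circ v t.
Proof.
  intros Hu Hv Ht H. apply RInt_le; try (apply ex_RInt_circ; assumption).
  - generalize PI_RGT_0; lra.
  - intros th _; apply H.
Qed.

Lemma circ_const (c t : R) : circ (fun _ => c) t = 2 * PI * c.
Proof. unfold circ. rewrite RInt_const. change (scal (2 * PI - 0) c) with ((2 * PI - 0) * c). ring. Qed.

Lemma circ_scal (c : R) (u : C -> R) (t : R) :
  disk_cont u -> t < 0 -> circ (fun z => c * u z) t = c * circ u t.
Proof.
  intros Hu Ht. unfold circ. apply (RInt_scal (V := R_CompleteNormedModule)).
  apply ex_RInt_circ; assumption.
Qed.

Lemma circ_plus (u v : C -> R) (t : R) :
  disk_cont u -> disk_cont v -> t < 0 -> circ (fun z => u z + v z) t = circ u t + circ v t.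
Proof.
  intros Hu Hv Ht. unfold circ. apply (RInt_plus (V := R_CompleteNormedModule));
  apply ex_RInt_circ; assumption.
Qed.

Lemma circ_ext (u v : C -> R) (t : R) :
  (forall th, u (polar t th) = v (polar t th)) -> circ u t = circ v t.
Proof. intros H. apply RInt_ext. intros th _; apply H. Qed.

(** * Holomorphic functions on the disk *)

(** [F'] is a complex derivative of [F] on the open unit disk. *)
Definition holo (F F' : C -> C) : Prop := forall z : C, in_disk z -> cderiv F z (F' z).

Lemma holo_continuous_re (F F' : C -> C) : holo F F' -> disk_cont (fun z => Re (F z)).
Proof.
  intros H z Hz. apply (continuous_comp F fst).
  - apply cderiv_continuous with (F' z), H, Hz.
  - destruct (F z); apply continuous_fst.
Qed.

Lemma holo_continuous_im (F F' : C -> C) : holo F F' -> disk_cont (fun z => Im (F z)).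
Proof.
  intros H z Hz. apply (continuous_comp F snd).
  - apply cderiv_continuous with (F' z), H, Hz.
  - destruct (F z); apply continuous_snd.
Qed.

Lemma disk_cont_plus (u v : C -> R) :
  disk_cont u -> disk_cont v -> disk_cont (fun z => u z + v z).
Proof. intros Hu Hv z Hz. apply (continuous_plus (V := R_NormedModule)); [apply Hu, Hz | apply Hv, Hz]. Qed.

Lemma disk_cont_mult (u v : C -> R) :
  disk_cont u -> disk_cont v -> disk_cont (fun z => u z * v z).
Proof. intros Hu Hv z Hz. apply (continuous_mult (K := R_AbsRing)); [apply Hu, Hz | apply Hv, Hz]. Qed.

Lemma disk_cont_const (c : R) : disk_cont (fun _ => c).
Proof. intros z _. apply continuous_const. Qed.

Lemma disk_cont_ext (u v : C -> R) : (forall z, u z = v z) -> disk_cont u -> disk_cont v.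
Proof. intros H Hu z Hz. apply continuous_ext with u; [exact H | apply Hu, Hz]. Qed.

(** [F] is [k] times complex differentiable on the disk.  Quantifying over the
    successive derivatives, instead of naming them, makes stability under
    products a plain induction. *)
Fixpoint holo_n (k : nat) (F : C -> C) : Prop :=
  match k with
  | O => True
  | S k => exists F' : C -> C, holo F F' /\ holo_n k F'
  end.

Lemma holo_n_pred (k : nat) (F : C -> C) : holo_n (S k) F -> holo_n k F.
Proof.
  revert F; induction k as [|k IH]; intros F [F' [H1 H2]]; [exact I|].
  exists F'; split; [exact H1 | apply IH, H2].
Qed.

Lemma holo_n_plus (k : nat) (F G : C -> C) :
  holo_n k F -> holo_n k G -> holo_n k (fun z => F z + G z)%C.
Proof.
  revert F G; induction k as [|k IH]; intros F G; [intros; exact I|].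
  intros [F' [HF1 HF2]] [G' [HG1 HG2]].
  exists (fun z => F' z + G' z)%C; split; [|apply IH; assumption].
  intros z Hz. apply cderiv_plus; [apply HF1, Hz | apply HG1, Hz].
Qed.

Lemma holo_mult (F F' G G' : C -> C) :
  holo F F' -> holo G G' ->
  holo (fun z => F z * G z)%C (fun z => F' z * G z + F z * G' z)%C.
Proof. intros HF HG z Hz. apply cderiv_mult; [apply HF, Hz | apply HG, Hz]. Qed.

Lemma holo_n_mult (k : nat) (F G : C -> C) :
  holo_n k F -> holo_n k G -> holo_n k (fun z => F z * G z)%C.
Proof.
  revert F G; induction k as [|k IH]; intros F G; [intros; exact I|].
  intros HF HG.
  pose proof (holo_n_pred _ _ HF) as HF0. pose proof (holo_n_pred _ _ HG) as HG0.
  destruct HF as [F' [HF1 HF2]]. destruct HG as [G' [HG1 HG2]].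
  exists (fun z => F' z * G z + F z * G' z)%C; split; [apply holo_mult; assumption|].
  apply holo_n_plus; apply IH; assumption.
Qed.

Lemma analytic_holo_n (k : nat) (f : C -> C) : analytic_on_disk f -> holo_n k f.
Proof.
  revert f; induction k as [|k IH]; intros f Hf; [exact I|].
  destruct (analytic_derive f Hf) as [H1 H2].
  exists (C_derive f); split; [exact H2 | apply IH, H1].
Qed.

(** * Hardy's identity and a comparison principle *)

(** The real scalar product of two complex-valued functions,
    [Re (F * conj G)]. *)
Definition dot (F G : C -> C) (z : C) : R := Re (F z) * Re (G z) + Im (F z) * Im (G z).

(** The function [z F'(z)], built from the derivative [F']: the derivative of
    [F] with respect to the logarithm of the radius. *)
Definition euler (F' : C -> C) (z : C) : C := (z * F' z)%C.

Lemma dot_self (F : C -> C) (z : C) : dot F F z = Cmod (F z) ^ 2.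
Proof. rewrite Cmod2_alt. unfold dot. ring. Qed.

Lemma dot_bound (F G : C -> C) (z : C) : Rabs (dot F G z) <= Cmod (F z) * Cmod (G z).
Proof.
  replace (dot F G z) with (Re (F z * Cconj (G z))).
  - eapply Rle_trans; [apply re_le_Cmod|]. rewrite Cmod_mult, Cmod_conj. apply Rle_refl.
  - rewrite re_mult, re_conj, im_conj. unfold dot. ring.
Qed.

Lemma holo_euler (F F' : C -> C) :
  holo F F' -> holo (euler F) (fun z => F z + z * F' z)%C.
Proof.
  intros H z Hz.
  replace (F z + z * F' z)%C with (RtoC 1 * F z + z * F' z)%C by ring.
  apply (cderiv_mult (fun z => z) F); [apply cderiv_id | apply H, Hz].
Qed.

Lemma disk_cont_dot (F F' G G' : C -> C) :
  holo F F' -> holo G G' -> disk_cont (dot F G).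
Proof.
  intros HF HG. unfold dot.
  apply disk_cont_plus; apply disk_cont_mult;
    (eapply holo_continuous_re; eassumption) || (eapply holo_continuous_im; eassumption).
Qed.

Lemma is_derive_dot (a b c d : R -> R) (t a' b' c' d' : R) :
  is_derive a t a' -> is_derive b t b' -> is_derive c t c' -> is_derive d t d' ->
  is_derive (fun s => a s * c s + b s * d s) t
    ((a' * c t + b' * d t) + (a t * c' + b t * d')).
Proof.
  intros Ha Hb Hc Hd.
  evar_last.
  - apply (is_derive_plus (V := R_NormedModule));
      (apply (is_derive_mult (K := R_AbsRing)); [eassumption | eassumption |
         intros n m; apply Rmult_comm]).
  - simpl. unfold plus, mult; simpl. ring.
Qed.

Lemma is_derive_circ_dot (F F' F'' G G' G'' : C -> C) (t : R) :
  holo F F' -> holo F' F'' -> holo G G' -> holo G' G'' -> t < 0 ->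
  is_derive (circ (dot F G)) t (circ (dot (euler F') G) t + circ (dot F (euler G')) t).
Proof.
  intros HF HF' HG HG' Ht.
  assert (HP := holo_euler _ _ HF'). assert (HQ := holo_euler _ _ HG').
  rewrite <- circ_plus;
    [| eapply disk_cont_dot; eassumption | eapply disk_cont_dot; eassumption | exact Ht].
  apply is_derive_circ.
  - intros s th Hs. pose proof (polar_in_disk s th Hs) as Hz.
    destruct (is_derive_polar_radial F s th _ (HF _ Hz)) as [H1 H2].
    destruct (is_derive_polar_radial G s th _ (HG _ Hz)) as [H3 H4].
    exact (is_derive_dot _ _ _ _ _ _ _ _ _ H1 H2 H3 H4).
  - eapply disk_cont_dot; eassumption.
  - apply disk_cont_plus; eapply disk_cont_dot; eassumption.
  - exact Ht.
Qed.

Lemma polar_2PI (t : R) : polar t (2 * PI) = polar t 0.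
Proof. unfold polar. rewrite cos_2PI, sin_2PI, cos_0, sin_0. reflexivity. Qed.

(** With [P = z F'] and [Q = z P'], the difference of the two integrands is the
    angular derivative of [Im (conj F * P)], which is periodic. *)
Lemma circ_dot_by_parts (F F' F'' F''' : C -> C) (t : R) :
  holo F F' -> holo F' F'' -> holo F'' F''' -> t < 0 ->
  circ (dot F (euler (fun z => F' z + z * F'' z)%C)) t
    = circ (dot (euler F') (euler F')) t.
Proof.
  intros HF HF' HF'' Ht.
  assert (HP := holo_euler _ _ HF').
  set (Q := euler (fun z => F' z + z * F'' z)%C).
  assert (HQ : exists Q', holo Q Q').
  { destruct (holo_n_mult 1 (fun z => z) (fun z => F' z + z * F'' z)%C) as [Q' [HQ' _]].
    - exists (fun _ => RtoC 1). split; [intros z _; apply cderiv_id | exact I].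
    - apply holo_n_plus; [exists F''; split; [exact HF' | exact I]|].
      apply holo_n_mult.
      + exists (fun _ => RtoC 1). split; [intros z _; apply cderiv_id | exact I].
      + exists F'''; split; [exact HF'' | exact I].
    - exists Q'; exact HQ'. }
  destruct HQ as [Q' HQ].
  set (P := euler F').
  assert (HPc : disk_cont (dot P P)) by (eapply disk_cont_dot; eassumption).
  assert (HQc : disk_cont (dot F Q)) by (eapply disk_cont_dot; eassumption).
  assert (HPc' : disk_cont (fun z => -1 * dot P P z))
    by (apply disk_cont_mult; [apply disk_cont_const | exact HPc]).
  assert (E : circ (fun z => dot F Q z + -1 * dot P P z) t = 0).
  { unfold circ.
    apply is_RInt_unique.
    (* The boundary values, at angles [2 * PI] and [0], of [Im (conj F * P)]. *)
    replace 0 with (minus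
      (Re (F (polar t (2 * PI))) * Im (P (polar t (2 * PI))) + Im (F (polar t (2 * PI))) * (-1 * Re (P (polar t (2 * PI)))))
      (Re (F (polar t 0)) * Im (P (polar t 0)) + Im (F (polar t 0)) * (-1 * Re (P (polar t 0)))))
      at 2.
    2: { rewrite polar_2PI. unfold minus, plus, opp; simpl. ring. }
    apply (is_RInt_derive (V := R_CompleteNormedModule)
      (fun th => Re (F (polar t th)) * Im (P (polar t th)) + Im (F (polar t th)) * (-1 * Re (P (polar t th))))).
    - intros th _. pose proof (polar_in_disk t th Ht) as Hz.
      destruct (is_derive_polar_angular F t th _ (HF _ Hz)) as [H1 H2].
      destruct (is_derive_polar_angular P t th _ (HP _ Hz)) as [H3 H4].
      assert (H5 := is_derive_scal _ _ (-1) _ H3).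
      evar_last; [exact (is_derive_dot _ _ _ _ _ _ _ _ _ H1 H2 H4 H5)|].
      unfold dot. fold (euler F' (polar t th)). fold P.
      change (polar t th * (F' (polar t th) + polar t th * F'' (polar t th)))%C
        with (Q (polar t th)).
      real_ring.
    - intros th _. apply (continuous_polar_angular (fun z => dot F Q z + -1 * dot P P z)).
      apply disk_cont_plus; [exact HQc | exact HPc' | apply polar_in_disk, Ht]. }
  rewrite circ_plus, circ_scal in E; try assumption. lra.
Qed.

(** In the variable [t], the first derivative of the integral of [|F|^2] and,
    up to a factor [2], its second derivative. *)
Lemma hardy_identity (F F' F'' F''' : C -> C) (t : R) :
  holo F F' -> holo F' F'' -> holo F'' F''' -> t < 0 ->
  is_derive (circ (dot F F)) t (2 * circ (dot F (euler F')) t) /\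
  is_derive (circ (dot F (euler F'))) t (2 * circ (dot (euler F') (euler F')) t).
Proof.
  intros HF HF' HF'' Ht.
  assert (HP := holo_euler _ _ HF').
  split.
  - evar_last; [apply (is_derive_circ_dot F F' F'' F F' F''); assumption|].
    rewrite (circ_ext (dot (euler F') F) (dot F (euler F'))).
    + real_ring.
    + intros th. unfold dot. ring.
  - destruct (holo_n_plus 1 F' (fun z => z * F'' z)%C) as [R' [HR' _]].
    + exists F''; split; [exact HF' | exact I].
    + apply holo_n_mult.
      * exists (fun _ => RtoC 1). split; [intros z _; apply cderiv_id | exact I].
      * exists F'''; split; [exact HF'' | exact I].
    + evar_last.
      * apply (is_derive_circ_dot F F' F'' (euler F') (fun z => F' z + z * F'' z)%C R');
          assumption.
      * rewrite (circ_dot_by_parts F F' F'' F''') by assumption.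
        real_ring.
Qed.

Lemma is_derive_nonneg_le (h dh : R -> R) (s t : R) :
  s <= t -> (forall x, s <= x <= t -> is_derive h x (dh x)) ->
  (forall x, s <= x <= t -> 0 <= dh x) -> h s <= h t.
Proof.
  intros Hst Hd Hp.
  destruct (MVT_gen h s t dh) as [c [Hc E]]; rewrite ?Rmin_left, ?Rmax_right in * by lra.
  - intros x Hx. apply Hd. lra.
  - intros x Hx. apply continuity_pt_filterlim.
    apply (ex_derive_continuous (V := R_NormedModule)). exists (dh x). apply Hd, Hx.
  - assert (0 <= dh c * (t - s)) by (apply Rmult_le_pos; [apply Hp, Hc | lra]). lra.
Qed.

(** First-order behaviour at the origin of a function vanishing there; both
    [F(z)] and [z F'(z)] are [F'(0) z] up to [o(z)]. *)
Lemma holo_near_0 (F F' F'' : C -> C) :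
  holo F F' -> holo F' F'' -> F 0 = RtoC 0 ->
  exists K, 0 < K /\ forall eps, 0 < eps -> exists d, 0 < d /\ forall z, Cmod z < d ->
    Cmod (F z) <= K * Cmod z /\ Cmod (euler F' z) <= K * Cmod z /\
    Cmod (euler F' z - F z) <= eps * Cmod z.
Proof.
  intros HF HF' HF0.
  assert (Hz0 : in_disk 0) by (unfold in_disk; rewrite Cmod_0; lra).
  pose proof (HF _ Hz0) as H1. pose proof (HF' _ Hz0) as H2.
  set (l0 := F' 0) in *. set (l1 := F'' 0) in *.
  pose proof (Cmod_ge_0 l0) as Hl0. pose proof (Cmod_ge_0 l1) as Hl1.
  exists (Cmod l0 + 1); split; [lra|]. intros eps Heps.
  destruct (H1 (Rmin (eps / 2) 1)) as [d1 [Hd1 Hw1]]; [apply Rmin_glb_lt; lra|].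
  destruct (H2 1) as [d2 [Hd2 Hw2]]; [lra|].
  set (q := Rmin (eps / 2) 1 / (Cmod l1 + 1)).
  assert (Hm0 : 0 < Rmin (eps / 2) 1) by (apply Rmin_glb_lt; lra).
  assert (Hq : 0 < q) by (apply Rdiv_lt_0_compat; lra).
  exists (Rmin d1 (Rmin d2 q)). split; [repeat apply Rmin_glb_lt; assumption|].
  intros z Hz.
  assert (Hzd1 : Cmod z < d1) by (eapply Rlt_le_trans; [exact Hz | apply Rmin_l]).
  assert (Hzd2 : Cmod z < d2) by (eapply Rlt_le_trans; [exact Hz | eapply Rle_trans; [apply Rmin_r | apply Rmin_l]]).
  assert (Hzq : Cmod z < q) by (eapply Rlt_le_trans; [exact Hz | eapply Rle_trans; [apply Rmin_r | apply Rmin_r]]).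
  pose proof (Cmod_ge_0 z) as Hz1.
  assert (Ez : (z - 0)%C = z) by ring.
  specialize (Hw1 z); specialize (Hw2 z). rewrite Ez in *.
  specialize (Hw1 Hzd1); specialize (Hw2 Hzd2). rewrite HF0 in Hw1. fold l0 in Hw2.
  pose proof (Rmin_l (eps / 2) 1) as Hml. pose proof (Rmin_r (eps / 2) 1) as Hmr.
  set (m := Rmin (eps / 2) 1) in *.
  assert (A1 : Cmod (F z - l0 * z) <= m * Cmod z).
  { replace (F z - l0 * z)%C with (F z - 0 - l0 * z)%C by ring. exact Hw1. }
  assert (A2 : Cmod (F' z - l0) <= m).
  { replace (F' z - l0)%C with ((F' z - l0 - l1 * z) + l1 * z)%C by ring.
    eapply Rle_trans; [apply Cmod_triangle|]. rewrite Cmod_mult.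
    apply Rle_trans with ((Cmod l1 + 1) * q).
    - apply Rle_trans with ((Cmod l1 + 1) * Cmod z); [lra|].
      apply Rmult_le_compat_l; lra.
    - unfold q. right. field. lra. }
  assert (A3 : Cmod (euler F' z - l0 * z) <= m * Cmod z).
  { unfold euler. replace (z * F' z - l0 * z)%C with ((F' z - l0) * z)%C by ring.
    rewrite Cmod_mult. apply Rmult_le_compat_r; assumption. }
  assert (B : forall w, Cmod (w - l0 * z) <= m * Cmod z -> Cmod w <= (Cmod l0 + 1) * Cmod z).
  { intros w Hw. replace w with ((w - l0 * z) + l0 * z)%C by ring.
    eapply Rle_trans; [apply Cmod_triangle|]. rewrite Cmod_mult.
    assert (m * Cmod z <= 1 * Cmod z) by (apply Rmult_le_compat_r; assumption). lra. }
  split; [apply B, A1|]. split; [apply B, A3|].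
  replace (euler F' z - F z)%C with ((euler F' z - l0 * z) + - (F z - l0 * z))%C by ring.
  eapply Rle_trans; [apply Cmod_triangle|]. rewrite Cmod_opp.
  assert (m * Cmod z <= eps / 2 * Cmod z) by (apply Rmult_le_compat_r; assumption). lra.
Qed.

Lemma exp_small (d t : R) : 0 < d -> exists s, s < t /\ s < 0 /\ exp s < d.
Proof.
  intros Hd. exists (Rmin (Rmin t 0) (ln d) - 1).
  pose proof (Rmin_l (Rmin t 0) (ln d)). pose proof (Rmin_r (Rmin t 0) (ln d)).
  pose proof (Rmin_l t 0). pose proof (Rmin_r t 0).
  repeat split; [lra | lra |].
  rewrite <- (exp_ln d Hd) at 2. apply exp_increasing. lra.
Qed.

Lemma circ_abs_le (u : C -> R) (t c : R) :
  disk_cont u -> t < 0 -> (forall th, Rabs (u (polar t th)) <= c) ->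
  Rabs (circ u t) <= 2 * PI * c.
Proof.
  intros Hu Ht H. apply Rabs_le. split.
  - replace (- (2 * PI * c)) with (2 * PI * - c) by ring. rewrite <- (circ_const (- c) t).
    apply circ_le; [apply disk_cont_const | exact Hu | exact Ht|].
    intros th. specialize (H th). apply Rabs_le_between in H. lra.
  - rewrite <- (circ_const c t).
    apply circ_le; [exact Hu | apply disk_cont_const | exact Ht|].
    intros th. specialize (H th). apply Rabs_le_between in H. lra.
Qed.

(** The logarithmic derivative of the mean square of [F] is at least twice that
    mean square, when [F] vanishes at the origin. *)
Lemma circ_dot_le_circ_dot_euler (F F' F'' F''' : C -> C) :
  holo F F' -> holo F' F'' -> holo F'' F''' -> F 0 = RtoC 0 ->
  forall t, t < 0 -> circ (dot F F) t <= circ (dot F (euler F')) t.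
Proof.
  intros HF HF' HF'' HF0 t Ht.
  assert (HP := holo_euler _ _ HF').
  set (P := euler F') in *.
  assert (C1 : disk_cont (dot F F)) by (eapply disk_cont_dot; eassumption).
  assert (C2 : disk_cont (dot F P)) by (eapply disk_cont_dot; eassumption).
  assert (C3 : disk_cont (dot P P)) by (eapply disk_cont_dot; eassumption).
  (* [W] is half the [t]-derivative of the integral of [|F(z)/z|^2]: it is
     nondecreasing, and it tends to [0] at the origin. *)
  set (W := fun s => exp (-2 * s) * (circ (dot F P) s - circ (dot F F) s)).
  assert (HW : forall s, s <= t -> W s <= W t).
  { intros s Hs.
    (* The last factor is the integral of [|P - F|^2]. *)
    apply is_derive_nonneg_le with
      (dh := fun s => 2 * exp (-2 * s) * (circ (dot P P) s - 2 * circ (dot F P) s + circ (dot F F) s));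
      [exact Hs | |]; intros x Hxt; assert (Hx : x < 0) by lra.
    - destruct (hardy_identity F F' F'' F''' x HF HF' HF'' Hx) as [H1 H2].
      fold P in H1, H2.
      unfold W. evar_last.
      + apply (is_derive_mult (K := R_AbsRing)).
        * instantiate (1 := -2 * exp (-2 * x)). auto_derive; [exact I | ring].
        * apply (is_derive_minus (V := R_NormedModule)); [exact H2 | exact H1].
        * intros n m; apply Rmult_comm.
      + unfold plus, mult, minus, opp, plus; simpl. ring.
    - apply Rmult_le_pos; [generalize (exp_pos (-2 * x)); lra|].
      replace (circ (dot P P) x - 2 * circ (dot F P) x + circ (dot F F) x) with
        (circ (fun z => dot P P z + (-2 * dot F P z + dot F F z)) x).
      + rewrite <- (Rmult_0_r (2 * PI)), <- (circ_const 0 x).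
        apply circ_le; [apply disk_cont_const | | exact Hx |].
        * apply disk_cont_plus; [assumption|]. apply disk_cont_plus; [|assumption].
          apply disk_cont_mult; [apply disk_cont_const | assumption].
        * intros th. unfold dot.
          generalize (Re (P (polar x th))) (Im (P (polar x th)))
            (Re (F (polar x th))) (Im (F (polar x th))).
          intros a b c d.
          generalize (pow2_ge_0 (a - c)) (pow2_ge_0 (b - d)). simpl. lra.
      + assert (C4 : disk_cont (fun z => -2 * dot F P z))
          by (apply disk_cont_mult; [apply disk_cont_const | assumption]).
        rewrite circ_plus, circ_plus, circ_scal; try assumption; [ring|].
        apply disk_cont_plus; assumption. }
  (* If [W t] were negative, [W] would stay below a negative constant near the
     origin, where [F] is [O(z)] and [P - F] is [o(z)]. *)
  assert (HW0 : 0 <= W t).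
  { apply Rnot_lt_le. intros Hneg.
    destruct (holo_near_0 F F' F'' HF HF' HF0) as [K [HK H0]].
    set (e := - W t / (4 * PI * K)).
    pose proof PI_RGT_0 as HPI.
    assert (HPK : 0 < PI * K) by (apply Rmult_lt_0_compat; assumption).
    assert (He : 0 < e) by (apply Rdiv_lt_0_compat; lra).
    destruct (H0 e He) as [d [Hd Hz]].
    destruct (exp_small d t Hd) as [s [Hst [Hs Hes]]].
    assert (Hs1 := HW s (Rlt_le _ _ Hst)).
    assert (HPF : holo (fun z => P z + RtoC (-1) * F z)%C
       (fun z => (F' z + z * F'' z) + (RtoC 0 * F z + RtoC (-1) * F' z))%C).
    { intros z Hzd. apply cderiv_plus; [apply HP, Hzd|].
      apply (cderiv_mult (fun _ => RtoC (-1))); [apply cderiv_const | apply HF, Hzd]. }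
    assert (C5 : disk_cont (dot F (fun z => P z + RtoC (-1) * F z)%C))
      by (eapply disk_cont_dot; eassumption).
    assert (Hb : Rabs (circ (dot F (fun z => P z + RtoC (-1) * F z)%C) s)
        <= 2 * PI * (K * e * exp (2 * s))).
    { apply circ_abs_le; [exact C5 | exact Hs |]. intros th.
      eapply Rle_trans; [apply dot_bound|].
      destruct (Hz (polar s th)) as [B1 [_ B3]]; [rewrite Cmod_polar; exact Hes|].
      fold P in B3. rewrite Cmod_polar in B1, B3.
      replace (P (polar s th) + RtoC (-1) * F (polar s th))%C with
        (P (polar s th) - F (polar s th))%C
        by (apply injective_projections; simpl; ring).
      replace (K * e * exp (2 * s)) with ((K * exp s) * (e * exp s)).
      - apply Rmult_le_compat; try apply Cmod_ge_0; assumption.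
      - replace (2 * s) with (s + s) by ring. rewrite exp_plus. ring. }
    assert (Ed : circ (dot F P) s - circ (dot F F) s = circ (dot F (fun z => P z + RtoC (-1) * F z)%C) s).
    { replace (circ (dot F P) s - circ (dot F F) s) with
        (circ (fun z => dot F P z + -1 * dot F F z) s).
      - apply circ_ext. intros th. unfold dot.
        rewrite re_plus, im_plus, re_scal_l, im_scal_l. ring.
      - rewrite circ_plus, circ_scal; try assumption; [ring|].
        apply disk_cont_mult; [apply disk_cont_const | assumption]. }
    rewrite <- Ed in Hb. apply Rabs_le_between in Hb. destruct Hb as [Hb _].
    assert (Hc : exp (-2 * s) * - (2 * PI * (K * e * exp (2 * s))) <= W s).
    { unfold W. apply Rmult_le_compat_l; [apply Rlt_le, exp_pos | exact Hb]. }
    assert (Hee : exp (-2 * s) * exp (2 * s) = 1)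
      by (rewrite <- exp_plus; replace (-2 * s + 2 * s) with 0 by ring; apply exp_0).
    replace (exp (-2 * s) * - (2 * PI * (K * e * exp (2 * s)))) with
      (- (2 * PI * K * e) * (exp (-2 * s) * exp (2 * s))) in Hc by ring.
    rewrite Hee in Hc.
    assert (E2 : 2 * PI * K * e = - W t / 2) by (unfold e; field; lra).
    lra. }
  unfold W in HW0. pose proof (exp_pos (-2 * t)).
  apply Rnot_lt_le. intros Hneg.
  assert (0 < exp (-2 * t) * (circ (dot F F) t - circ (dot F P) t))
    by (apply Rmult_lt_0_compat; lra).
  lra.
Qed.

(** A majorant for the integral of [|F|^2] from an inequality between second
    and first derivatives in [t]; note the weight [1 - exp (2 t)]. *)
Lemma circ_comparison (F F' F'' F''' : C -> C) (V V' : R -> R) :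
  holo F F' -> holo F' F'' -> holo F'' F''' -> F 0 = RtoC 0 ->
  (forall t, t < 0 -> is_derive V t (V' t)) -> (forall t, t < 0 -> 0 <= V t) ->
  (forall t, t < 0 -> 4 * (1 - exp (2 * t)) * circ (dot (euler F') (euler F')) t <= V' t) ->
  forall t, t < 0 -> circ (dot F F) t <= V t.
Proof.
  intros HF HF' HF'' HF0 HV HV0 HVle t Ht.
  assert (HP := holo_euler _ _ HF').
  set (P := euler F') in *.
  assert (C1 : disk_cont (dot F F)) by (eapply disk_cont_dot; eassumption).
  assert (C2 : disk_cont (dot F P)) by (eapply disk_cont_dot; eassumption).
  assert (C3 : disk_cont (dot P P)) by (eapply disk_cont_dot; eassumption).
  set (E0 := exp (2 * t)).
  assert (HE0 : 0 < E0) by apply exp_pos.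
  (* [Phi] is nondecreasing on the half-line below [t]; its value at [t] is
     [E0] times the desired difference, and its lower limit at [-oo] is
     nonnegative. *)
  set (Phi := fun s => E0 * V s - (E0 - exp (2 * s)) * (2 * circ (dot F P) s) - exp (2 * s) * circ (dot F F) s).
  assert (HPP : forall s, s < 0 -> 0 <= circ (dot P P) s).
  { intros s Hs. rewrite <- (Rmult_0_r (2 * PI)), <- (circ_const 0 s).
    apply circ_le; [apply disk_cont_const | exact C3 | exact Hs |].
    intros th. rewrite dot_self. apply pow2_ge_0. }
  assert (HPhi : forall s, s < t -> Phi s <= Phi t).
  { intros s Hs.
    set (dPhi := fun s => E0 * V' s - (E0 - exp (2 * s)) * (4 * circ (dot P P) s)
         + 2 * exp (2 * s) * (circ (dot F P) s - circ (dot F F) s)).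
    assert (HdPhi : forall x, x < 0 -> is_derive Phi x (dPhi x)).
    { intros x Hx. destruct (hardy_identity F F' F'' F''' x HF HF' HF'' Hx) as [H1 H2].
      fold P in H1, H2. assert (H3 := HV x Hx).
      unfold Phi. evar_last.
      - apply (is_derive_minus (V := R_NormedModule));
          [apply (is_derive_minus (V := R_NormedModule))|].
        + apply is_derive_scal, H3.
        + apply (is_derive_mult (K := R_AbsRing)).
          * instantiate (1 := - (2 * exp (2 * x))). auto_derive; [exact I | ring].
          * apply is_derive_scal, H2.
          * intros n m; apply Rmult_comm.
        + apply (is_derive_mult (K := R_AbsRing)).
          * instantiate (1 := 2 * exp (2 * x)). auto_derive; [exact I | ring].
          * exact H1.
          * intros n m; apply Rmult_comm.
      - unfold dPhi, minus, opp, plus, mult; simpl. ring. }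
    apply is_derive_nonneg_le with (dh := dPhi); [lra | |]; intros c Hc;
      assert (Hc0 : c < 0) by lra; [apply HdPhi, Hc0|].
    unfold dPhi.
    assert (T1 := circ_dot_le_circ_dot_euler F F' F'' F''' HF HF' HF'' HF0 c Hc0).
    fold P in T1.
    assert (T2 : 0 <= 2 * exp (2 * c) * (circ (dot F P) c - circ (dot F F) c)).
    { apply Rmult_le_pos; [generalize (exp_pos (2 * c)); lra | lra]. }
    assert (T3 : (E0 - exp (2 * c)) * (4 * circ (dot P P) c) <= E0 * V' c).
    { apply Rle_trans with (E0 * (4 * (1 - exp (2 * c)) * circ (dot P P) c)).
      - replace (E0 * (4 * (1 - exp (2 * c)) * circ (dot P P) c)) with
          ((E0 - E0 * exp (2 * c)) * (4 * circ (dot P P) c)) by ring.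
        apply Rmult_le_compat_r; [generalize (HPP c Hc0); lra|].
        assert (E0 <= 1) by (unfold E0; rewrite <- exp_0; apply Rlt_le, exp_increasing; lra).
        assert (E0 * exp (2 * c) <= 1 * exp (2 * c))
          by (apply Rmult_le_compat_r; [apply Rlt_le, exp_pos | assumption]).
        lra.
      - apply Rmult_le_compat_l; [lra | apply HVle, Hc0]. }
    lra. }
  assert (Ht0 : Phi t = E0 * (V t - circ (dot F F) t)).
  { unfold Phi. fold E0. ring. }
  apply Rnot_lt_le. intros Hneg.
  assert (Hneg2 : 0 < - Phi t).
  { rewrite Ht0. assert (0 < E0 * (circ (dot F F) t - V t)) by (apply Rmult_lt_0_compat; lra). lra. }
  (* If the difference is negative, then [Phi s > Phi t] for [s] close to [-oo]:
     this contradicts the monotonicity of [Phi]. *)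
  destruct (holo_near_0 F F' F'' HF HF' HF0) as [K [HK H0]].
  destruct (H0 1 Rlt_0_1) as [d [Hd Hz]].
  pose proof PI_RGT_0 as HPI.
  assert (HK2 : 0 < 2 * PI * (K * K)).
  { apply Rmult_lt_0_compat; [lra | apply Rmult_lt_0_compat; exact HK]. }
  set (q := - Phi t / (2 * (2 * PI * (K * K)) * (2 * E0 + 1))).
  assert (Hq : 0 < q).
  { apply Rdiv_lt_0_compat; [exact Hneg2|].
    apply Rmult_lt_0_compat; [apply Rmult_lt_0_compat|]; lra. }
  destruct (exp_small (Rmin d (Rmin q 1)) t) as [s [Hst [Hs Hes]]];
    [repeat apply Rmin_glb_lt; lra|].
  assert (Hes1 : exp s < d) by (eapply Rlt_le_trans; [exact Hes | apply Rmin_l]).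
  assert (Hes2 : exp s < q) by (eapply Rlt_le_trans; [exact Hes | eapply Rle_trans; [apply Rmin_r | apply Rmin_l]]).
  assert (Hes3 : exp s < 1) by (eapply Rlt_le_trans; [exact Hes | eapply Rle_trans; [apply Rmin_r | apply Rmin_r]]).
  pose proof (exp_pos s) as Hes0.
  assert (E2s : exp (2 * s) = exp s * exp s)
    by (replace (2 * s) with (s + s) by ring; apply exp_plus).
  assert (HeE : exp (2 * s) < E0) by (apply exp_increasing; lra).
  assert (Hsmall : exp (2 * s) < q).
  { rewrite E2s. apply Rle_lt_trans with (exp s * 1); [apply Rmult_le_compat_l; lra | lra]. }
  assert (HB : forall G, disk_cont (dot F G) -> (forall z, Cmod z < d -> Cmod (G z) <= K * Cmod z) ->
     circ (dot F G) s <= 2 * PI * (K * K) * exp (2 * s)).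
  { intros G HG HGK. eapply Rle_trans; [apply Rle_abs|].
    rewrite Rmult_assoc. apply circ_abs_le; [exact HG | exact Hs |]. intros th.
    eapply Rle_trans; [apply dot_bound|].
    assert (Hm : Cmod (polar s th) < d) by (rewrite Cmod_polar; exact Hes1).
    destruct (Hz (polar s th) Hm) as [B1 _]. specialize (HGK _ Hm).
    rewrite Cmod_polar in B1, HGK. rewrite E2s.
    replace (K * K * (exp s * exp s)) with ((K * exp s) * (K * exp s)) by ring.
    apply Rmult_le_compat; try apply Cmod_ge_0; assumption. }
  assert (HB1 := HB F C1 (fun z Hm => proj1 (Hz z Hm))).
  assert (HB2 := HB P C2 (fun z Hm => proj1 (proj2 (Hz z Hm)))).
  assert (Hfin := HPhi s Hst).
  assert (HVs : 0 <= E0 * V s) by (apply Rmult_le_pos; [lra | apply HV0, Hs]).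
  unfold Phi in Hfin at 1.
  set (k := 2 * PI * (K * K)) in *.
  assert (S1 : (E0 - exp (2 * s)) * (2 * circ (dot F P) s) <= E0 * (2 * (k * exp (2 * s)))).
  { assert (0 <= k * exp (2 * s)) by (apply Rmult_le_pos; [lra | apply Rlt_le, exp_pos]).
    apply Rle_trans with ((E0 - exp (2 * s)) * (2 * (k * exp (2 * s)))).
    - apply Rmult_le_compat_l; lra.
    - apply Rmult_le_compat_r; generalize (exp_pos (2 * s)); lra. }
  assert (S2 : exp (2 * s) * circ (dot F F) s <= 1 * (k * exp (2 * s))).
  { apply Rle_trans with (exp (2 * s) * (k * exp (2 * s))).
    - apply Rmult_le_compat_l; [apply Rlt_le, exp_pos | exact HB1].
    - apply Rmult_le_compat_r; [apply Rmult_le_pos; [lra | apply Rlt_le, exp_pos]|].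
      rewrite E2s. apply Rle_trans with (1 * 1); [|lra].
      apply Rmult_le_compat; lra. }
  assert (S3 : k * (2 * E0 + 1) * exp (2 * s) < k * (2 * E0 + 1) * q)
    by (apply Rmult_lt_compat_l; [apply Rmult_lt_0_compat; lra | exact Hsmall]).
  assert (S4 : k * (2 * E0 + 1) * q = - Phi t / 2) by (unfold q; field; lra).
  lra.
Qed.

(** * The function g *)

Lemma g_integrand_continuous (phi : R -> R) (t : R) :
  continuous phi t -> 0 < t -> continuous (fun t => phi t ^ 2 / t) t.
Proof.
  intros H Ht. apply (continuous_mult (K := R_AbsRing) (fun t => phi t ^ 2) Rinv).
  - apply continuous_ext with (fun s => mult (phi s) (phi s)).
    + intros s. unfold mult; simpl. ring.
    + apply (continuous_mult (K := R_AbsRing)); exact H.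
  - apply continuous_Rinv. lra.
Qed.

Lemma ex_RInt_g_integrand (phi : R -> R) (x y : R) :
  (forall t, 0 < t < 1 -> continuous phi t) -> 0 < x < 1 -> 0 < y < 1 ->
  ex_RInt (fun t => phi t ^ 2 / t) x y.
Proof.
  intros H Hx Hy. apply (ex_RInt_continuous (V := R_CompleteNormedModule)).
  intros t Ht.
  assert (0 < Rmin x y) by (apply Rmin_glb_lt; lra).
  assert (Rmax x y < 1) by (apply Rmax_lub_lt; lra).
  apply g_integrand_continuous; [apply H|]; lra.
Qed.

Lemma g_nonneg (phi : R -> R) (x : R) : 0 < x < 1 -> g_finite phi x -> 0 <= g phi x.
Proof.
  intros Hx Hg. unfold g_finite in Hg.
  assert (Hc : is_RInt_gen (fun t => phi t ^ 2 / t) (at_point x) (at_left 1) (g phi x))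
    by (apply (RInt_gen_correct (V := R_CompleteNormedModule)); exact Hg).
  apply Rnot_lt_le. intros Hneg.
  assert (Hopen : locally (g phi x) (fun y => y < 0)) by (apply open_lt; exact Hneg).
  specialize (Hc _ Hopen). destruct Hc as [Q T HQ [d HT] H].
  specialize (HT (1 - Rmin (d / 2) ((1 - x) / 2))).
  pose proof (cond_pos d) as Hd.
  pose proof (Rmin_l (d / 2) ((1 - x) / 2)). pose proof (Rmin_r (d / 2) ((1 - x) / 2)).
  assert (0 < Rmin (d / 2) ((1 - x) / 2)) by (apply Rmin_glb_lt; lra).
  set (m := Rmin (d / 2) ((1 - x) / 2)) in *.
  assert (HTm : T (1 - m)).
  { apply HT; [|lra]. change (Rabs ((1 - m) - 1) < d).
    rewrite Rabs_left; lra. }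
  destruct (H x (1 - m) HQ HTm) as [y [Hy Hy0]]. simpl in Hy.
  apply (Rlt_irrefl 0). apply Rle_lt_trans with y; [|exact Hy0].
  apply (is_RInt_ge_0 (fun t => phi t ^ 2 / t) x (1 - m) y); [lra | exact Hy |].
  intros t Ht. apply Rmult_le_pos; [apply pow2_ge_0 | apply Rlt_le, Rinv_0_lt_compat; lra].
Qed.

Lemma g_Chasles (phi : R -> R) (x y : R) :
  (forall t, 0 < t < 1 -> continuous phi t) -> 0 < x < 1 -> 0 < y < 1 -> g_finite phi y ->
  g phi x = RInt (fun t => phi t ^ 2 / t) x y + g phi y.
Proof.
  intros H Hx Hy Hg. unfold g at 1.
  apply (is_RInt_gen_unique (V := R_CompleteNormedModule)).
  apply (is_RInt_gen_Chasles (V := R_NormedModule) (fun t => phi t ^ 2 / t) y).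
  - apply is_RInt_gen_at_point. apply (RInt_correct (V := R_CompleteNormedModule)).
    apply ex_RInt_g_integrand; assumption.
  - apply (RInt_gen_correct (V := R_CompleteNormedModule)). exact Hg.
Qed.

Lemma is_derive_g (phi : R -> R) (x : R) :
  (forall t, 0 < t < 1 -> continuous phi t) -> (forall y, 0 < y < 1 -> g_finite phi y) ->
  0 < x < 1 -> is_derive (g phi) x (- (phi x ^ 2 / x)).
Proof.
  intros H Hg Hx.
  assert (Hn : locally x (fun y => 0 < y < 1)).
  { apply filter_and; [apply open_gt | apply open_lt]; lra. }
  apply is_derive_ext_loc with (fun y => RInt (fun t => phi t ^ 2 / t) y x + g phi x).
  - eapply filter_imp; [|exact Hn]. intros y Hy. symmetry. apply g_Chasles; auto.
  - evar_last.
    + apply (is_derive_plus (V := R_NormedModule)); [|apply is_derive_const].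
      apply (is_derive_RInt' (fun t => phi t ^ 2 / t) _ x x).
      * eapply filter_imp; [|exact Hn]. intros y Hy.
        apply (RInt_correct (V := R_CompleteNormedModule)), ex_RInt_g_integrand; assumption.
      * apply g_integrand_continuous; [apply H|]; lra.
    + unfold plus, opp, zero; simpl. ring.
Qed.

Lemma exp2_lt_1 (t : R) : t < 0 -> 0 < 1 - exp (2 * t) < 1.
Proof.
  intros H. assert (exp (2 * t) < 1) by (rewrite <- exp_0; apply exp_increasing; lra).
  generalize (exp_pos (2 * t)); lra.
Qed.

Lemma is_derive_g_log (phi : R -> R) (t : R) :
  (forall t, 0 < t < 1 -> continuous phi t) -> (forall y, 0 < y < 1 -> g_finite phi y) ->
  t < 0 -> is_derive (fun s => g phi (1 - exp (2 * s))) t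
    (2 * exp (2 * t) * phi (1 - exp (2 * t)) ^ 2 / (1 - exp (2 * t))).
Proof.
  intros H Hg Ht.
  assert (Hx := exp2_lt_1 t Ht).
  evar_last.
  - apply (is_derive_comp (K := R_AbsRing) (V := R_NormedModule) (g phi) (fun s => 1 - exp (2 * s))).
    + apply is_derive_g; assumption.
    + instantiate (1 := - (2 * exp (2 * t))). auto_derive; [exact I | ring].
  - unfold scal, mult; simpl. unfold mult; simpl. field. lra.
Qed.

(** * Moments *)

(** The pointwise power [f^n]. *)
Fixpoint fpow (f : C -> C) (n : nat) (z : C) : C :=
  match n with O => RtoC 1 | S n => (f z * fpow f n z)%C end.

Lemma Cmod_fpow (f : C -> C) (n : nat) (z : C) : Cmod (fpow f n z) = Cmod (f z) ^ n.
Proof. induction n as [|n IH]; simpl; [apply Cmod_1 | rewrite Cmod_mult, IH; reflexivity]. Qed.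

Lemma holo_n_fpow (k : nat) (f : C -> C) (n : nat) : holo_n k f -> holo_n k (fpow f n).
Proof.
  intros Hf. induction n as [|n IH].
  - simpl. clear Hf. assert (H : forall c, holo_n k (fun _ => c)).
    { induction k as [|k IH]; intros c; [exact I|]. exists (fun _ => RtoC 0).
      split; [intros z _; apply cderiv_const | apply IH]. }
    apply H.
  - apply (holo_n_mult k f (fpow f n)); assumption.
Qed.

Lemma holo_fpow (f f' : C -> C) (n : nat) :
  holo f f' -> holo (fpow f (S n)) (fun z => RtoC (INR (S n)) * (fpow f n z * f' z))%C.
Proof.
  intros Hf. induction n as [|n IH].
  - intros z Hz.
    replace (RtoC (INR 1) * (fpow f 0 z * f' z))%C with (f' z * fpow f 0 z + f z * RtoC 0)%C
      by (simpl; ring).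
    apply (cderiv_mult f (fpow f 0)); [apply Hf, Hz | apply cderiv_const].
  - intros z Hz.
    replace (RtoC (INR (S (S n))) * (fpow f (S n) z * f' z))%C with
      (f' z * fpow f (S n) z + f z * (RtoC (INR (S n)) * (fpow f n z * f' z)))%C.
    + apply (cderiv_mult f (fpow f (S n))); [apply Hf, Hz | apply IH, Hz].
    + rewrite (S_INR (S n)), RtoC_plus. simpl fpow. ring.
Qed.

Lemma cderiv_unique (F : C -> C) (z l l' : C) : cderiv F z l -> cderiv F z l' -> l = l'.
Proof. intros H H'. rewrite <- (cderiv_C_derive F z l H). apply cderiv_C_derive, H'. Qed.

(** The induction on [n] described above, for any constant [K] that bounds
    [(1-|z|^2) |f'(z)| / phi(1-|z|^2)]. *)
Lemma moment_bound (phi : R -> R) (f f' : C -> C) (K : R) :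
  (forall t, 0 < t < 1 -> 0 < phi t) ->
  (forall t, 0 < t < 1 -> continuous phi t) -> (forall y, 0 < y < 1 -> g_finite phi y) ->
  holo_n 3 f -> holo f f' -> f 0 = RtoC 0 -> 0 <= K ->
  (forall z, in_disk z -> z <> RtoC 0 ->
    (1 - Cmod z ^ 2) * Cmod (f' z) <= K * phi (1 - Cmod z ^ 2)) ->
  forall n t, t < 0 ->
    circ (fun z => Cmod (f z) ^ (2 * n)) t <=
      2 * PI * (2 ^ n * INR (Factorial.fact n) * (K ^ 2 * g phi (1 - exp (2 * t))) ^ n).
Proof.
  intros Hphi Hc Hg Hf3 Hf Hf0 HK Hfb. induction n as [|n IH]; intros t Ht.
  - change (fun z => Cmod (f z) ^ (2 * 0)) with (fun _ : C => 1). rewrite circ_const. simpl. lra.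
  - pose proof PI_RGT_0 as HPI.
    set (F := fpow f (S n)).
    assert (HF3 := holo_n_fpow 3 f (S n) Hf3). fold F in HF3.
    destruct HF3 as [F1 [HF1 [F2 [HF2 [F3 [HF3 _]]]]]].
    rewrite (circ_ext _ (dot F F)).
    2: { intros th. rewrite dot_self. unfold F. rewrite Cmod_fpow.
         rewrite <- pow_mult. f_equal. lia. }
    set (G := fun s => g phi (1 - exp (2 * s))) in *.
    set (dG := fun s => 2 * exp (2 * s) * phi (1 - exp (2 * s)) ^ 2 / (1 - exp (2 * s))).
    assert (HG0 : forall s, s < 0 -> 0 <= G s).
    { intros s Hs. apply g_nonneg; [|apply Hg]; apply exp2_lt_1, Hs. }
    set (B := 2 * PI * (2 ^ S n * INR (Factorial.fact (S n)) * (K ^ 2) ^ S n)).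
    assert (HB : 0 <= B).
    { unfold B. apply Rmult_le_pos; [lra|]. apply Rmult_le_pos.
      - apply Rmult_le_pos; [apply pow_le; lra | apply pos_INR].
      - apply pow_le, pow2_ge_0. }
    replace (2 * PI * _) with (B * G t ^ S n) by (unfold B, G; rewrite Rpow_mult_distr; ring).
    apply (circ_comparison F F1 F2 F3 (fun s => B * G s ^ S n)
      (fun s => B * (INR (S n) * dG s * G s ^ n))); try assumption.
    + unfold F; simpl. rewrite Hf0. ring.
    + intros s Hs. apply is_derive_scal.
      evar_last.
      * apply is_derive_pow. apply is_derive_g_log; assumption.
      * unfold dG, G. simpl pred. ring.
    + intros s Hs. apply Rmult_le_pos; [exact HB | apply pow_le, HG0, Hs].
    + intros s Hs.
      assert (Hx := exp2_lt_1 s Hs).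
      set (x := 1 - exp (2 * s)) in *.
      assert (Ex : exp (2 * s) = 1 - x) by (unfold x; ring).
      assert (E2s : exp (2 * s) = exp s ^ 2)
        by (replace (2 * s) with (s + s) by ring; rewrite exp_plus; ring).
      assert (HP := holo_euler _ _ HF2).
      assert (HC1 : disk_cont (fun z => Cmod (f z) ^ (2 * n))).
      { apply disk_cont_ext with (dot (fpow f n) (fpow f n)).
        - intros z. rewrite dot_self, Cmod_fpow, <- pow_mult. f_equal. lia.
        - destruct (holo_n_fpow 1 f n) as [Fn' [HFn' _]].
          + apply holo_n_pred, holo_n_pred, Hf3.
          + eapply disk_cont_dot; eassumption. }
      (* The pointwise bound [|z F'|^2 <= c |f|^(2n)] for [F = f^(n+1)]. *)
      set (c := INR (S n) ^ 2 * (1 - x) * K ^ 2 * phi x ^ 2 / x ^ 2).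
      assert (Hle : circ (dot (euler F1) (euler F1)) s <=
          c * circ (fun z => Cmod (f z) ^ (2 * n)) s).
      { rewrite <- circ_scal by assumption.
        apply circ_le; [eapply disk_cont_dot; eassumption | | exact Hs |].
        - apply disk_cont_mult; [apply disk_cont_const | exact HC1].
        - intros th. assert (Hz := polar_in_disk s th Hs).
          set (z := polar s th) in *.
          rewrite dot_self. unfold euler.
          rewrite (cderiv_unique F z (F1 z) _ (HF1 z Hz) (holo_fpow f f' n Hf z Hz)).
          rewrite !Cmod_mult, Cmod_fpow, Cmod_R, Rabs_pos_eq by apply pos_INR.
          assert (Ez : Cmod z = exp s) by apply Cmod_polar.
          assert (Hzn : z <> RtoC 0).
          { apply Cmod_gt_0. rewrite Ez. apply exp_pos. }
          specialize (Hfb z Hz Hzn). rewrite Ez, <- E2s in Hfb. fold x in Hfb.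
          rewrite Ez.
          assert (Hfb2 : Cmod (f' z) <= K * phi x / x).
          { apply Rmult_le_reg_l with x; [lra|].
            replace (x * (K * phi x / x)) with (K * phi x) by (field; lra). exact Hfb. }
          assert (Hfb3 : Cmod (f' z) ^ 2 <= (K * phi x / x) ^ 2)
            by (apply pow_incr; split; [apply Cmod_ge_0 | exact Hfb2]).
          replace ((exp s * (INR (S n) * (Cmod (f z) ^ n * Cmod (f' z)))) ^ 2) with
            ((INR (S n) ^ 2 * exp (2 * s) * Cmod (f z) ^ (2 * n)) * Cmod (f' z) ^ 2)
            by (rewrite E2s; replace (2 * n)%nat with (n + n)%nat by lia;
                rewrite pow_add; ring).
          replace (c * Cmod (f z) ^ (2 * n)) with
            ((INR (S n) ^ 2 * exp (2 * s) * Cmod (f z) ^ (2 * n)) * (K * phi x / x) ^ 2)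
            by (unfold c; rewrite Ex; field; lra).
          apply Rmult_le_compat_l; [|exact Hfb3].
          apply Rmult_le_pos; [|apply pow_le, Cmod_ge_0].
          apply Rmult_le_pos; [apply pow2_ge_0 | apply Rlt_le, exp_pos]. }
      assert (Hc0 : 0 <= c).
      { unfold c. apply Rmult_le_pos; [|apply Rlt_le, Rinv_0_lt_compat, pow_lt; lra].
        apply Rmult_le_pos; [|apply pow2_ge_0].
        apply Rmult_le_pos; [|apply pow2_ge_0].
        apply Rmult_le_pos; [apply pow2_ge_0 | lra]. }
      specialize (IH s Hs). fold (G s) in IH.
      apply Rle_trans with (4 * x * (c * (2 * PI * (2 ^ n * INR (Factorial.fact n) * (K ^ 2 * G s) ^ n)))).
      * apply Rmult_le_compat_l; [lra|].
        eapply Rle_trans; [exact Hle|]. apply Rmult_le_compat_l; [exact Hc0 | exact IH].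
      * right. unfold B, c, dG. fold x. rewrite Ex.
        rewrite fact_simpl, mult_INR, !Rpow_mult_distr.
        rewrite <- (tech_pow_Rmult 2 n), <- (tech_pow_Rmult (K ^ 2) n).
        generalize ((K ^ 2) ^ n). intros Kn. field. lra.
Qed.

(** * From moments to exponential integrals *)

(** The Taylor polynomial of degree [n] of the exponential. *)
Definition exp_sum (n : nat) (y : R) : R :=
  sum_f_R0 (fun k => / INR (Factorial.fact k) * y ^ k) n.

Lemma is_lim_seq_exp_sum (y : R) : is_lim_seq (fun n => exp_sum n y) (exp y).
Proof.
  apply is_lim_seq_Reals. unfold exp. destruct (exist_exp y) as [l Hl]. exact Hl.
Qed.

(** The Taylor remainder is nondecreasing on the half-line of nonnegative
    numbers, so on the interval from [0] to [L] it is largest at [L]. *)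
Lemma exp_minus_exp_sum_le (y L : R) (n : nat) :
  0 <= y <= L -> exp y - exp L <= exp_sum n y - exp_sum n L.
Proof.
  intros Hy.
  apply (is_lim_seq_decr_compare (fun n => exp_sum n y - exp_sum n L)).
  - apply is_lim_seq_minus'; apply is_lim_seq_exp_sum.
  - intros k. unfold exp_sum. simpl sum_f_R0.
    assert (y ^ S k <= L ^ S k) by (apply pow_incr; lra).
    assert (/ INR (Factorial.fact (S k)) * y ^ S k <= / INR (Factorial.fact (S k)) * L ^ S k).
    { apply Rmult_le_compat_l; [|assumption].
      apply Rlt_le, Rinv_0_lt_compat, INR_fact_lt_0. }
    simpl in *. lra.
Qed.

(** If, on average over the interval, [y^n] is at most [n! / 2^n] for all [n],
    then the average of [exp y] is at most [3]: the Taylor terms contribute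
    at most [1 + 1/2 + 1/4 + ...], and the remainder at most [1]. *)
Lemma RInt_exp_le (y : R -> R) (a b : R) :
  a <= b -> (forall s, continuous y s) -> (forall s, 0 <= y s) ->
  (forall n, RInt (fun s => y s ^ n) a b <= (b - a) * INR (Factorial.fact n) * (/ 2) ^ n) ->
  RInt (fun s => exp (y s)) a b <= 3 * (b - a).
Proof.
  intros Hab Hc Hy0 Hm.
  assert (Hpow : forall n s, continuous (fun s => y s ^ n) s).
  { induction n as [|n IH]; intros s; [apply continuous_const|].
    apply (continuous_mult (K := R_AbsRing) y (fun s => y s ^ n)); [apply Hc | apply IH]. }
  assert (Hex : forall u : R -> R, (forall s, continuous u s) -> ex_RInt u a b).
  { intros u Hu. apply (ex_RInt_continuous (V := R_CompleteNormedModule)). intros s _; apply Hu. }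
  assert (Hterm : forall n s, continuous (fun s => / INR (Factorial.fact n) * y s ^ n) s).
  { intros n s. apply (continuous_scal_r (V := R_NormedModule)). apply Hpow. }
  assert (Hsum : forall n s, continuous (fun s => exp_sum n (y s)) s).
  { induction n as [|n IH]; intros s.
    - apply (Hterm 0%nat).
    - apply (continuous_plus (V := R_NormedModule) (fun s => exp_sum n (y s))
        (fun s => / INR (Factorial.fact (S n)) * y s ^ S n)); [apply IH | apply Hterm]. }
  assert (Hterm_le : forall n, RInt (fun s => / INR (Factorial.fact n) * y s ^ n) a b <= (b - a) * (/ 2) ^ n).
  { intros n.
    replace (RInt _ a b) with (/ INR (Factorial.fact n) * RInt (fun s => y s ^ n) a b)
      by (symmetry; apply (RInt_scal (V := R_CompleteNormedModule)); apply Hex, Hpow).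
    assert (Hf := INR_fact_lt_0 n).
    apply Rle_trans with (/ INR (Factorial.fact n) * ((b - a) * INR (Factorial.fact n) * (/ 2) ^ n)).
    - apply Rmult_le_compat_l; [apply Rlt_le, Rinv_0_lt_compat, Hf | apply Hm].
    - right. field. lra. }
  assert (Hsum_le : forall n, RInt (fun s => exp_sum n (y s)) a b <= (b - a) * (2 - (/ 2) ^ n)).
  { induction n as [|n IH].
    - generalize (Hterm_le 0%nat). unfold exp_sum. simpl. lra.
    - assert (E : RInt (fun s => exp_sum (S n) (y s)) a b =
        RInt (fun s => exp_sum n (y s)) a b +
        RInt (fun s => / INR (Factorial.fact (S n)) * y s ^ S n) a b).
      { apply (RInt_plus (V := R_CompleteNormedModule) (fun s => exp_sum n (y s)));
          apply Hex; [apply Hsum | apply Hterm]. }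
      rewrite E. generalize (Hterm_le (S n)). simpl ((/ 2) ^ S n). lra. }
  destruct (continuity_ab_maj y a b Hab) as [m [Hmax _]].
  { intros c _. apply continuity_pt_filterlim, Hc. }
  set (L := y m) in *.
  assert (HN : exists n, exp L - exp_sum n L <= 1).
  { assert (Hl := is_lim_seq_exp_sum L). apply is_lim_seq_Reals in Hl.
    destruct (Hl 1 Rlt_0_1) as [N HN]. exists N.
    specialize (HN N (le_n N)). unfold Rdist in HN.
    apply Rabs_lt_between in HN. lra. }
  destruct HN as [n Hn].
  apply Rle_trans with (RInt (fun s => exp_sum n (y s) + 1) a b).
  - apply RInt_le; [exact Hab | | |].
    + apply Hex. intros s. apply (continuous_comp y exp); [apply Hc | apply continuous_exp].
    + apply Hex. intros s. apply (continuous_plus (V := R_NormedModule)); [apply Hsum | apply continuous_const].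
    + intros s Hs. assert (Hs' : a <= s <= b) by lra.
      generalize (exp_minus_exp_sum_le (y s) L n (conj (Hy0 s) (Hmax s Hs'))). lra.
  - assert (E : RInt (fun s => exp_sum n (y s) + 1) a b =
      RInt (fun s => exp_sum n (y s)) a b + RInt (fun _ => 1) a b).
    { apply (RInt_plus (V := R_CompleteNormedModule)); [apply Hex, Hsum | apply ex_RInt_const]. }
    rewrite E, RInt_const. change (scal (b - a) 1) with ((b - a) * 1).
    generalize (Hsum_le n).
    assert (0 <= (b - a) * (/ 2) ^ n) by (apply Rmult_le_pos; [lra | apply pow_le; lra]).
    lra.
Qed.

(** A finite norm is a nonnegative real number, and it dominates all the
    quotients of which it is the supremum. *)
Lemma B_norm_bound (phi : R -> R) (f : C -> C) :
  (forall t, 0 < t < 1 -> 0 < phi t) -> Rbar_lt (B_norm phi f) p_infty ->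
  0 <= real (B_norm phi f) /\
  forall z, in_disk z -> z <> RtoC 0 ->
    (1 - Cmod z ^ 2) * Cmod (C_derive f z) <= real (B_norm phi f) * phi (1 - Cmod z ^ 2).
Proof.
  intros Hphi Hfin.
  assert (Hw : forall z, in_disk z -> z <> RtoC 0 -> 0 < 1 - Cmod z ^ 2 < 1).
  { intros z Hz Hz0. unfold in_disk in Hz. apply Cmod_gt_0 in Hz0.
    assert (0 < Cmod z * Cmod z) by (apply Rmult_lt_0_compat; assumption).
    assert (Cmod z * Cmod z < 1 * 1) by (apply Rmult_le_0_lt_compat; lra).
    simpl. lra. }
  unfold B_norm in *. set (A := fun y : R => _) in *.
  destruct (Lub_Rbar_correct A) as [Hub _].
  assert (HA : forall z, in_disk z -> z <> RtoC 0 ->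
    Rbar_le ((1 - Cmod z ^ 2) * Cmod (C_derive f z) / phi (1 - Cmod z ^ 2)) (Lub_Rbar A)).
  { intros z Hz Hz0. apply Hub. exists z. repeat split; assumption. }
  assert (Hpos : forall z, in_disk z -> z <> RtoC 0 ->
    0 <= (1 - Cmod z ^ 2) * Cmod (C_derive f z) / phi (1 - Cmod z ^ 2)).
  { intros z Hz Hz0. destruct (Hw z Hz Hz0).
    apply Rmult_le_pos.
    - apply Rmult_le_pos; [lra | apply Cmod_ge_0].
    - apply Rlt_le, Rinv_0_lt_compat, Hphi. lra. }
  assert (Hh : in_disk (RtoC (/ 2)) /\ RtoC (/ 2) <> RtoC 0).
  { assert (E : Cmod (RtoC (/ 2)) = / 2) by (rewrite Cmod_R; apply Rabs_pos_eq; lra).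
    split; [unfold in_disk; lra | apply Cmod_gt_0; lra]. }
  destruct Hh as [Hh1 Hh2].
  assert (H1 := HA _ Hh1 Hh2). assert (H2 := Hpos _ Hh1 Hh2).
  destruct (Lub_Rbar A) as [l| |] eqn:EL; [|contradiction|contradiction].
  simpl in *. split; [lra|].
  intros z Hz Hz0. destruct (Hw z Hz Hz0).
  assert (Hp : 0 < phi (1 - Cmod z ^ 2)) by (apply Hphi; simpl; lra).
  assert (H3 := HA z Hz Hz0).
  apply Rmult_le_reg_r with (/ phi (1 - Cmod z ^ 2)); [apply Rinv_0_lt_compat, Hp|].
  simpl in *. unfold Rdiv in H3. eapply Rle_trans; [exact H3|].
  right. field. lra.
Qed.

Theorem theorem2 :
  exists gamma M : R, 0 < gamma /\ 0 < M /\
    forall phi : R -> R,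
      (forall t : R, 0 < t < 1 -> 0 < phi t) ->
      (forall t : R, 0 < t < 1 -> continuous phi t) ->
      (forall x : R, 0 < x < 1 -> g_finite phi x) ->
      forall f : C -> C,
        in_B phi f ->
        f (RtoC 0) = RtoC 0 ->
        (exists z : C, in_disk z /\ f z <> RtoC 0) ->
        forall r : R, 0 < r < 1 ->
          circle_integral (fun zeta : C =>
            exp (gamma * Cmod (f (r * zeta)%C) /
                 (real (B_norm phi f) * sqrt (g phi (1 - r ^ 2))))) <= M.
Proof.
  exists (/ 2), (3 * exp (/ 4)).
  split; [lra|]. split; [generalize (exp_pos (/ 4)); lra|].
  intros phi Hphi Hc Hg f [Hf Hfin] Hf0 _ r Hr.
  destruct (B_norm_bound phi f Hphi Hfin) as [HK Hfb].
  set (K := real (B_norm phi f)) in *.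
  set (t := ln r).
  assert (Ht : t < 0) by (unfold t; rewrite <- ln_1; apply ln_increasing; lra).
  assert (Er : exp t = r) by (apply exp_ln; lra).
  assert (E2 : exp (2 * t) = r ^ 2)
    by (replace (2 * t) with (t + t) by ring; rewrite exp_plus, Er; ring).
  assert (Hx := exp2_lt_1 t Ht). rewrite E2 in Hx.
  set (G := g phi (1 - r ^ 2)).
  assert (HG : 0 <= G) by (apply g_nonneg; [exact Hx | apply Hg, Hx]).
  set (D := K * sqrt G).
  assert (HD : D ^ 2 = K ^ 2 * G).
  { unfold D. rewrite Rpow_mult_distr. f_equal.
    simpl. rewrite Rmult_1_r. apply sqrt_sqrt, HG. }
  pose proof PI_RGT_0 as HPI.
  assert (Hholo := proj2 (analytic_derive f Hf)).
  (* Below, [y] is [x^2 / 4] with [x = |f| / D].  If [D = 0], then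
     [/ D = 0], and all the estimates still hold. *)
  set (c := / 4 * (/ D) ^ 2).
  assert (Hc0 : 0 <= c) by (apply Rmult_le_pos; [lra | apply pow2_ge_0]).
  set (y := fun th => c * Cmod (f (polar t th)) ^ 2).
  assert (Hycont : forall th, continuous y th).
  { intros th. unfold y. apply (continuous_scal_r (V := R_NormedModule)).
    apply (continuous_polar_angular (fun z => Cmod (f z) ^ 2)).
    apply (disk_cont_ext (dot f f)).
    - intros z; apply dot_self.
    - eapply disk_cont_dot; exact Hholo.
    - apply polar_in_disk, Ht. }
  assert (Hint : RInt (fun th => exp (y th)) 0 (2 * PI) <= 3 * (2 * PI - 0)).
  { apply RInt_exp_le; [lra | exact Hycont | |].
    - intros th. apply Rmult_le_pos; [exact Hc0 | apply pow2_ge_0].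
    - intros n.
      assert (Hmom := moment_bound phi f (C_derive f) K Hphi Hc Hg
        (analytic_holo_n 3 f Hf) Hholo Hf0 HK Hfb n t Ht).
      rewrite E2 in Hmom. fold G in Hmom. rewrite <- HD in Hmom.
      rewrite (RInt_ext _ (fun th => c ^ n * Cmod (f (polar t th)) ^ (2 * n))).
      2: { intros th _. unfold y. rewrite Rpow_mult_distr, pow_mult. reflexivity. }
      assert (Hcn : 0 <= c ^ n) by (apply pow_le, Hc0).
      assert (Hcirc : RInt (fun th => c ^ n * Cmod (f (polar t th)) ^ (2 * n)) 0 (2 * PI)
         = c ^ n * circ (fun z => Cmod (f z) ^ (2 * n)) t).
      { apply (RInt_scal (V := R_CompleteNormedModule)).
        apply (ex_RInt_circ (fun z => Cmod (f z) ^ (2 * n))); [|exact Ht].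
        destruct (holo_n_fpow 1 f n) as [F' [HF' _]].
        - exists (C_derive f); split; [exact Hholo | exact I].
        - apply disk_cont_ext with (dot (fpow f n) (fpow f n)).
          + intros z. rewrite dot_self, Cmod_fpow, <- pow_mult. f_equal. lia.
          + eapply disk_cont_dot; exact HF'. }
      rewrite Hcirc.
      apply Rle_trans with (c ^ n * (2 * PI * (2 ^ n * INR (Factorial.fact n) * (D ^ 2) ^ n))).
      + apply Rmult_le_compat_l; assumption.
      + replace (c ^ n * (2 * PI * (2 ^ n * INR (Factorial.fact n) * (D ^ 2) ^ n))) with
          ((2 * PI - 0) * INR (Factorial.fact n) * (c * 2 * D ^ 2) ^ n)
          by (rewrite !Rpow_mult_distr; ring).
        apply Rmult_le_compat_l.
        * apply Rmult_le_pos; [lra | apply pos_INR].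
        * apply pow_incr. split.
          -- apply Rmult_le_pos; [lra | apply pow2_ge_0].
          -- unfold c. destruct (Req_dec D 0) as [E|E].
             ++ rewrite E. simpl. lra.
             ++ right. field. exact E. }
  unfold circle_integral.
  assert (Hle : RInt (fun th => exp (/ 2 * Cmod (f (r * (cos th, sin th))%C) / D)) 0 (2 * PI)
     <= exp (/ 4) * RInt (fun th => exp (y th)) 0 (2 * PI)).
  { assert (Hexy : ex_RInt (fun th => exp (y th)) 0 (2 * PI)).
    { apply (ex_RInt_continuous (V := R_CompleteNormedModule)). intros th _.
      apply (continuous_comp y exp); [apply Hycont | apply continuous_exp]. }
    replace (exp (/ 4) * RInt (fun th => exp (y th)) 0 (2 * PI)) with
      (RInt (fun th => exp (/ 4) * exp (y th)) 0 (2 * PI))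
      by (apply (RInt_scal (V := R_CompleteNormedModule)); exact Hexy).
    assert (Ez : forall th, (RtoC r * (cos th, sin th))%C = polar t th).
    { intros th. unfold polar. rewrite Er. apply injective_projections; simpl; ring. }
    rewrite (RInt_ext _ (fun th => exp (/ 2 * Cmod (f (polar t th)) / D)))
      by (intros th _; rewrite Ez; reflexivity).
    apply RInt_le; [lra | | |].
    - apply (ex_RInt_continuous (V := R_CompleteNormedModule)). intros th _.
      apply (continuous_comp (fun th => / 2 * Cmod (f (polar t th)) / D) exp);
        [|apply continuous_exp].
      apply continuous_ext with (fun th => (/ 2 * / D) * sqrt (dot f f (polar t th))).
      + intros s. rewrite dot_self, sqrt_pow2 by apply Cmod_ge_0. unfold Rdiv.
        real_ring.
      + apply (continuous_scal_r (V := R_NormedModule)).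
        apply (continuous_comp (fun s => dot f f (polar t s)) sqrt).
        * apply (continuous_polar_angular (dot f f)).
          eapply disk_cont_dot; [exact Hholo | exact Hholo | apply polar_in_disk, Ht].
        * apply continuous_sqrt.
    - apply (ex_RInt_scal (V := R_NormedModule)). exact Hexy.
    - (* With [x = |f| / D], this is [x / 2 <= 1 / 4 + x^2 / 4]. *)
      intros th _. rewrite <- exp_plus. apply Rnot_lt_le. intros Hlt.
      apply exp_lt_inv in Hlt. revert Hlt. unfold y, c, Rdiv.
      generalize (pow2_ge_0 (Cmod (f (polar t th)) * / D - 1)). simpl. lra. }
  assert (H2PI : 0 < / (2 * PI)) by (apply Rinv_0_lt_compat; lra).
  apply Rle_trans with (/ (2 * PI) * (exp (/ 4) * (3 * (2 * PI - 0)))).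
  - apply Rmult_le_compat_l; [lra|]. eapply Rle_trans; [exact Hle|].
    apply Rmult_le_compat_l; [apply Rlt_le, exp_pos | exact Hint].
  - right. field. lra.
Qed.
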